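(* Let $T$ be a complete first-order theory. Strict non-forking equals non-forking in $T$ (i.e. for all tuples $a,b$ and sets $A$, $a\downarrow^{st}_A b$ iff $\operatorname{tp}(a/Ab)$ does not fork over $A$) if and only if $T$ is simple.
   Context: Work in a monster model of $T$. $a\downarrow^{st}_A b$ means there is a global type $p\supseteq\operatorname{tp}(a/Ab)$ which does not fork over $A$ such that for every set $D\supseteq Ab$ and every $c\models p|_D$, $\operatorname{tp}(D/Ac)$ does not divide over $A$. *)

(* Defs.v *)
From mathcomp Require Import all_boot.
From mathcomp Require Import boolp classical_sets functions cardinality.

Set Implicit Arguments.
Unset Strict Implicit.
Unset Printing Implicit Defensive.

Local Open Scope classical_set_scope.
Local Open Scope card_scope.

(* Cardinals are represented by types, as in [cardinality]: [small K X] means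
   |X| < |K|. *)
Definition small (K U : Type) (X : set U) : Prop :=
  X #<= [set: K] /\ ~ ([set: K] #<= X).

Record signature := Signature {
  fsym : Type;
  far : fsym -> nat;
  rsym : Type;
  rar : rsym -> nat }.

Section Syntax.
Variable L : signature.

Inductive term (V : Type) : Type :=
| Var of V
| App (f : fsym L) of ('I_(far f) -> term V).

(* [formula V] is the type of L-formulas with free variables in V; a quantifier
   binds the variable [None] of [option V]. The variables may form any type, so
   that infinite tuples of variables (types of sets) need no special care. *)
Inductive formula (V : Type) : Type :=
| Bot
| Eq of term V & term V
| Rel (r : rsym L) of ('I_(rar r) -> term V)
| Imp of formula V & formula V
| All of formula (option V).

Definition Neg V (phi : formula V) : formula V := Imp phi (Bot V).

Definition sentence := formula void.

Fixpoint tmap V W (h : V -> W) (t : term V) : term W :=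
  match t with
  | Var v => Var (h v)
  | App f ts => App (fun i => tmap h (ts i))
  end.

Fixpoint fmap V W (h : V -> W) (phi : formula V) : formula W :=
  match phi with
  | Bot => Bot W
  | Eq s t => Eq (tmap h s) (tmap h t)
  | Rel r ts => Rel (fun i => tmap h (ts i))
  | Imp phi psi => Imp (fmap h phi) (fmap h psi)
  | All phi => All (fmap (omap h) phi)
  end.

Record structure := Structure {
  dom :> Type;
  dom_inhabited : inhabited dom;
  fint : forall f : fsym L, ('I_(far f) -> dom) -> dom;
  rint : forall r : rsym L, ('I_(rar r) -> dom) -> Prop }.

Fixpoint eval (M : structure) V (v : V -> M) (t : term V) : M :=
  match t with
  | Var x => v x
  | App f ts => fint (fun i => eval v (ts i))
  end.

Fixpoint sat (M : structure) V (v : V -> M) (phi : formula V) : Prop :=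
  match phi with
  | Bot => False
  | Eq s t => eval v s = eval v t
  | Rel r ts => rint (fun i => eval v (ts i))
  | Imp phi psi => sat v phi -> sat v psi
  | All phi => forall x : M, sat (fun o => if o is Some y then v y else x) phi
  end.

Definition holds (M : structure) (sigma : sentence) : Prop :=
  sat (M := M) (@of_void M) sigma.

Definition models (T : set sentence) (M : structure) : Prop :=
  forall sigma, T sigma -> holds M sigma.

Definition complete_theory (T : set sentence) : Prop :=
  (exists M, models T M) /\
  forall sigma, (forall M, models T M -> holds M sigma) \/
                (forall M, models T M -> holds M (Neg sigma)).

Definition sum_val (M I J : Type) (a : I -> M) (b : J -> M) (v : I + J) : M :=
  match v with inl i => a i | inr j => b j end.

(* phi(x; y) has the tree property with respect to k, the parameters being
   indexed by the nonempty finite sequences of natural numbers. Consistency of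
   a branch is finite satisfiability in the model N containing the tree. *)
Definition tree_property (T : set sentence) n m (phi : formula ('I_n + 'I_m))
    (k : nat) : Prop :=
  exists N : structure, models T N /\ exists c : seq nat -> 'I_m -> N,
    (forall (s : seq nat) (f : 'I_k -> nat), injective f ->
       ~ exists x : 'I_n -> N,
           forall j, sat (sum_val x (c (rcons s (f j)))) phi) /\
    (forall (eta : nat -> nat) (l : nat),
       exists x : 'I_n -> N,
         forall i, (i < l)%N -> sat (sum_val x (c (mkseq eta i.+1))) phi).

Definition simple (T : set sentence) : Prop :=
  ~ exists (n m : nat) (phi : formula ('I_n + 'I_m)) (k : nat),
      (2 <= k)%N /\ tree_property T phi k.

Section Types.
Variable M : structure.

(* Formulas in the variables I with parameters from M. *)
Definition pformula (I : Type) := formula (I + M).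

Definition inst I n (psi : formula (I + 'I_n)) (b : 'I_n -> M) : pformula I :=
  fmap (fun v => match v with inl i => inl i | inr j => inr (b j) end) psi.

Definition psat I (a : I -> M) (phi : pformula I) : Prop :=
  sat (sum_val a id) phi.

Definition realizes I (a : I -> M) (pi : set (pformula I)) : Prop :=
  forall phi, pi phi -> psat a phi.

(* L(B)-formulas in the variables I *)
Definition over I (B : set M) : set (pformula I) :=
  [set phi | exists n (psi : formula (I + 'I_n)) (b : 'I_n -> M),
     (forall j, B (b j)) /\ phi = inst psi b].

Definition tp I (a : I -> M) (B : set M) : set (pformula I) :=
  [set phi | over B phi /\ psat a phi].

Definition complete_type I (B : set M) (p : set (pformula I)) : Prop :=
  [/\ p `<=` over B,
      (forall F, finite_set F -> F `<=` p -> exists a : I -> M, realizes a F) &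
      (forall phi, over B phi -> p phi \/ p (Neg phi))].

Definition global_type I (p : set (pformula I)) : Prop :=
  complete_type [set: M] p.

Definition implies I (pi : set (pformula I)) (phi : pformula I) : Prop :=
  exists F, [/\ finite_set F, F `<=` pi &
                forall a : I -> M, realizes a F -> psat a phi].

Definition divides I (A : set M) (phi : pformula I) : Prop :=
  exists n (psi : formula (I + 'I_n)) (b : 'I_n -> M),
    phi = inst psi b /\
    exists (c : nat -> 'I_n -> M) (k : nat),
      (forall i, tp (c i) A = tp b A) /\
      (forall f : 'I_k -> nat, injective f ->
         ~ exists a : I -> M, forall j, psat a (inst psi (c (f j)))).

Definition forks I (A : set M) (phi : pformula I) : Prop :=
  exists F : set (pformula I),
    [/\ finite_set F, F `<=` divides A &
        forall a : I -> M, psat a phi -> exists2 psi, F psi & psat a psi].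

Definition type_divides I (A : set M) (pi : set (pformula I)) : Prop :=
  exists phi, implies pi phi /\ divides A phi.

Definition type_forks I (A : set M) (pi : set (pformula I)) : Prop :=
  exists phi, implies pi phi /\ forks A phi.

Definition nonforking_indep I J (A : set M) (a : I -> M) (b : J -> M) : Prop :=
  ~ type_forks A (tp a (A `|` range b)).

(* The type of a set D is the type of its enumeration [fun d : D => val d]. *)
Definition strict_indep (K I J : Type) (A : set M) (a : I -> M) (b : J -> M)
    : Prop :=
  exists p : set (pformula I),
    [/\ global_type p,
        tp a (A `|` range b) `<=` p,
        ~ type_forks A p &
        forall D : set M, small K D -> A `|` range b `<=` D ->
        forall c : I -> M, realizes c (p `&` over D) ->
          ~ type_divides A (tp (fun d : D => val d) (A `|` range c))].

Definition saturated (K : Type) : Prop :=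
  forall (B : set M), small K B ->
  forall n (p : set (pformula 'I_n)), complete_type B p ->
  exists a : 'I_n -> M, realizes a p.

Definition automorphism (h : M -> M) : Prop :=
  [/\ bijective h,
      (forall (f : fsym L) (x : 'I_(far f) -> M),
         h (fint x) = fint (h \o x)) &
      (forall (r : rsym L) (x : 'I_(rar r) -> M),
         rint (h \o x) <-> rint x)].

Definition strongly_homogeneous (K : Type) : Prop :=
  forall (I : Type) (a b : I -> M), small K [set: I] ->
    tp a set0 = tp b set0 ->
    exists h : M -> M, automorphism h /\ forall i, h (a i) = b i.

End Types.

(* M is a monster model of T for the cardinal kappa = |K|, where kappa > |T|
   (the number of L-formulas in countably many variables, hence infinite).
   "Small" then means of cardinality < kappa. *)
Definition monster (K : Type) (T : set sentence) (M : structure) : Prop :=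
  [/\ models T M, small K [set: formula nat],
      saturated M K & strongly_homogeneous M K].

End Syntax.

(* Main.v *)
From mathcomp Require filter.
Require Import Defs.
From mathcomp Require Import all_boot.
From mathcomp Require Import boolp classical_sets functions cardinality.
Import filter Defs.

(** If [T] is not simple, a path through a tree for [phi] yields [a] and tuples
    [c_i] such that [phi(a, c_i)] holds and [phi(x, c_i)] divides over
    [c_0, ..., c_(i-1)]. Let [A] be the set of entries of all [c_i] and let [w]
    realize a limit of the types of the [c_i] over [A a]. Then [tp(w/Aa)] is
    finitely satisfiable in [A], hence does not fork over [A], whereas [phi(x, w)],
    which [a] satisfies, divides over [A]; so [w] is not strictly independent of [a].

    Conversely, let [tp(a/Ab)] not fork over [A], extend it to a global nonforking
    type [p], and suppose that [c] realizes [p|D] while [theta(y, c)], satisfied by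
    [d] in [D], divides over [A]. Let [e_i] realize [p] over [D e_0 ... e_(i-1)].
    As [tp(e_j/A e_i ... e_(j-1))] does not divide over [A e_(i+1) ... e_(j-1)],
    [theta(y, e_i)] still divides over [A e_(i+1) ... e_j]. Read backwards,
    [e_0, ..., e_N] is a dividing chain realized by [d]; moving it around by
    automorphisms gives a tree of height [N] for [theta], so [T] is not simple.

    Indiscernible sequences are avoided throughout: the only source of
    compactness is that an ultrafilter on tuples is realized over small sets. *)

Set Implicit Arguments.
Unset Strict Implicit.
Unset Printing Implicit Defensive.

Local Open Scope classical_set_scope.
Local Open Scope card_scope.

(** * Formulas *)

Section Formulas.
Variable L : signature.
Implicit Types (M : structure L) (V W I : Type).

Lemma eval_tmap M V W (h : V -> W) (v : W -> M) (t : term L V) :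
  eval v (tmap h t) = eval (v \o h) t.
Proof. by elim: t => //= f ts IH; congr fint; apply/funext. Qed.

Lemma sat_fmap M V W (h : V -> W) (v : W -> M) (phi : formula L V) :
  sat v (fmap h phi) = sat (v \o h) phi.
Proof.
elim: phi W h v => {V} [V|V s t|V r ts|V phi IH1 psi IH2|V phi IH] W h v //=.
- by rewrite !eval_tmap.
- by congr rint; apply/funext => i; rewrite eval_tmap.
- by rewrite IH1 IH2.
- apply: eq_forall => x; rewrite IH.
  by congr sat; apply/funext => -[].
Qed.

Lemma tmap_tmap U V W (g : U -> V) (h : V -> W) (t : term L U) :
  tmap h (tmap g t) = tmap (h \o g) t.
Proof. by elim: t => //= f ts IH; congr App; apply/funext. Qed.

Lemma fmap_fmap U V W (g : U -> V) (h : V -> W) (phi : formula L U) :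
  fmap h (fmap g phi) = fmap (h \o g) phi.
Proof.
elim: phi V W g h => {U} [U|U s t|U r ts|U phi IH1 psi IH2|U phi IH] V W g h //=.
- by rewrite !tmap_tmap.
- by congr Rel; apply/funext => i; rewrite tmap_tmap.
- by rewrite IH1 IH2.
- by rewrite IH; congr (All (fmap _ _)); apply/funext => -[].
Qed.

Lemma term_finite_support V (t : term L V) :
  exists (W : finType) (h : W -> V) (s : term L W), t = tmap h s.
Proof.
elim: t => [v|f ts IH]; first by exists unit, (fun=> v), (Var L tt).
have /choice [F FP] : forall i, exists x : {W : finType & ((W -> V) * term L W)%type},
    ts i = tmap (projT2 x).1 (projT2 x).2.
  by move=> i; have [W [h [s E]]] := IH i; exists (existT _ W (h, s)).
exists {i : 'I_(far f) & projT1 (F i)}, (fun w => (projT2 (F (tag w))).1 (tagged w)).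
exists (App (fun i => tmap (fun w => Tagged (fun i => projT1 (F i)) w) (projT2 (F i)).2)).
by congr App; apply/funext => i; rewrite FP; apply/esym/tmap_tmap.
Qed.

Lemma formula_finite_support V (phi : formula L V) :
  exists (W : finType) (h : W -> V) (psi : formula L W), phi = fmap h psi.
Proof.
elim: phi => {V} [V|V s t|V r ts|V phi IH1 psi IH2|V phi IH].
- by exists void, (@of_void V), (Bot L void).
- have [W [h [s' ->]]] := term_finite_support s.
  have [W' [h' [t' ->]]] := term_finite_support t.
  exists (W + W')%type, (fun w => match w with inl x => h x | inr x => h' x end).
  by exists (Eq (tmap inl s') (tmap inr t')) => /=; rewrite !tmap_tmap.
- have /choice [F FP] : forall i, exists x : {W : finType & ((W -> V) * term L W)%type},
      ts i = tmap (projT2 x).1 (projT2 x).2.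
    by move=> i; have [W [h [s E]]] := term_finite_support (ts i);
      exists (existT _ W (h, s)).
  exists {i : 'I_(rar r) & projT1 (F i)},
    (fun w => (projT2 (F (tag w))).1 (tagged w)).
  exists (Rel (fun i => tmap (fun w => Tagged (fun i => projT1 (F i)) w) (projT2 (F i)).2)).
  by congr Rel; apply/funext => i; rewrite FP; apply/esym/tmap_tmap.
- have [W [h [s' ->]]] := IH1; have [W' [h' [t' ->]]] := IH2.
  exists (W + W')%type, (fun w => match w with inl x => h x | inr x => h' x end).
  by exists (Imp (fmap inl s') (fmap inr t')) => /=; rewrite !fmap_fmap.
(* Here [h] maps into [option V] but a map into [V] is needed: occurrences of the bound variable are
   sent to an arbitrary [v0]. If [V] is empty, every variable of the body is the bound one. *)
- have [W [h [psi ->]]] := IH; have [[v0]|NV] := pselect (inhabited V).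
    exists W, (fun w => odflt v0 (h w)).
    exists (All (fmap (fun w => if h w is Some _ then Some w else None) psi)) => /=.
    rewrite fmap_fmap; congr (All (fmap _ _)); apply/funext => w /=.
    by case E: (h w) => //=; rewrite E.
  exists void, (@of_void V), (All (fmap (fun=> None) psi)) => /=.
  rewrite fmap_fmap; congr (All (fmap _ _)); apply/funext => w /=.
  by case: (h w) => // v; case: NV.
Qed.

Definition And V (phi psi : formula L V) := Neg (Imp phi (Neg psi)).
Definition Ex V (phi : formula L (option V)) := Neg (All (Neg phi)).

Lemma sat_And M V (v : V -> M) phi psi :
  sat v (And phi psi) <-> sat v phi /\ sat v psi.
Proof.
split=> [H|[H1 H2] H3]; last exact: H3.
by split; apply: contrapT => H1; apply: H => // H2.
Qed.

Lemma sat_Ex M V (v : V -> M) phi :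
  sat v (Ex phi) <-> exists x : M, sat (fun o => if o is Some y then v y else x) phi.
Proof.
split=> [H|[x H1] H2]; last exact: (H2 x).
by apply: contrapT => /forallNP H1; apply: H.
Qed.

Definition bigAnd V (s : seq (formula L V)) := foldr (@And V) (Neg (Bot L V)) s.

Lemma sat_bigAnd M V (v : V -> M) (T : finType) (F : T -> formula L V) :
  sat v (bigAnd [seq F x | x <- enum T]) <-> forall x, sat v (F x).
Proof.
have: sat v (bigAnd [seq F x | x <- enum T]) <->
      forall x, x \in enum T -> sat v (F x).
  elim: (enum T) => [|y s IH]; first by split=> // _ [].
  rewrite -[bigAnd _]/(And _ (bigAnd _)) sat_And; split=> [[Hy /IH Hs] x|H].
    by rewrite inE => /predU1P[->|/Hs].
  split; first by apply: H; rewrite mem_head.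
  by apply/IH => x xs; apply: H; rewrite inE xs orbT.
by move=> ->; split=> H x *; apply: H; rewrite mem_enum.
Qed.

Lemma exists_ord_formula n V (phi : formula L (V + 'I_n)) :
  exists chi : formula L V, forall M (v : V -> M),
    sat v chi <-> exists x : 'I_n -> M, sat (sum_val v x) phi.
Proof.
elim: n V phi => [|n IH] V phi.
  have ord_elim : 'I_0 -> V by case.
  exists (fmap (fun s => match s with inl x => x | inr i => ord_elim i end) phi) => M v.
  have E (x : 'I_0 -> M) : v \o (fun s => match s with inl x => x | inr i => ord_elim i end)
                         = sum_val v x by apply/funext; case=> [u|[]].
  rewrite sat_fmap; split=> [|[x]]; last by rewrite -E.
  have x0 : 'I_0 -> M by case.
  by exists x0; rewrite -E.
pose h (s : V + 'I_n.+1) : option V + 'I_n :=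
  match s with
  | inl x => inl (Some x)
  | inr i => if unlift ord0 i is Some j then inr j else inl None
  end.
have [chi chiP] := IH _ (fmap h phi); exists (Ex chi) => M v.
rewrite sat_Ex; split=> [[x /chiP [y]]|[x Hx]].
  rewrite sat_fmap => H.
  exists (fun i => if unlift ord0 i is Some j then y j else x).
  congr (sat _ _): H; apply/funext => -[u|i] //=; by case: unlift.
exists (x ord0); apply/chiP; exists (x \o lift ord0); rewrite sat_fmap.
congr (sat _ _): Hx; apply/funext => -[u|i] //=.
by case: unliftP => [j ->|->].
Qed.

(** This quantifies over a possibly infinite tuple. Only finitely many variables occur, so it
    suffices to quantify over a tuple indexed by [W] and to demand that it comes from a valuation of
    [I + V]. *)
Lemma exists_formula I V (phi : formula L (I + V)) :
  exists chi : formula L V, forall M (v : V -> M),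
    sat v chi <-> exists a : I -> M, sat (sum_val a v) phi.
Proof.
have [W [h [psi ->]]] := formula_finite_support phi.
pose vr w := Var L (inr (enum_rank w)) : term L (V + 'I_#|W|).
(* [F] forces equal values on occurrences of the same variable; [G] ties the free variables to their
   given values. *)
pose F (p : W * W) := if `[< h p.1 = h p.2 >] then Eq (vr p.1) (vr p.2)
  else Neg (Bot L _).
pose G w := if h w is inr x then Eq (vr w) (Var L (inl x)) else Neg (Bot L _).
pose Phi := And (bigAnd [seq F p | p <- enum {: W * W}])
   (And (bigAnd [seq G w | w <- enum W]) (fmap (fun w => inr (enum_rank w)) psi)).
have [chi chiP] := exists_ord_formula Phi.
exists chi => M v; rewrite chiP; split=> [[x]|[a]].
  rewrite !sat_And !sat_bigAnd sat_fmap => -[HF [HG Hpsi]].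
  have [m0] := dom_inhabited M.
  (* By [F] the choice of [w] does not matter; variables that do not occur get the default [m0]. *)
  pose a i := if pselect (exists w, h w = inl i) is left e
    then x (enum_rank (projT1 (cid e))) else m0.
  exists a; rewrite sat_fmap; congr (sat _ _): Hpsi; apply/funext => w /=.
  case E: (h w) => [i|y] /=; last by move: (HG w); rewrite /G E.
  rewrite /a; case: pselect => [e|[]]; last by exists w.
  case: (cid e) => w' /= E'; have := HF (w, w').
  by rewrite /F /= E E'; case: asboolP.
rewrite sat_fmap => H; exists (fun i => sum_val a v (h (enum_val i))).
rewrite !sat_And !sat_bigAnd sat_fmap; split; last split.
- move=> [w w']; rewrite /F; case: asboolP => //= E.
  by rewrite !enum_rankK E.
- by move=> w; rewrite /G; case E: (h w) => //=; rewrite enum_rankK E.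
- by congr (sat _ _): H; apply/funext => w /=; rewrite enum_rankK.
Qed.

End Formulas.

(** * Definable sets *)

Section Definability.
Variables (L : signature) (M : structure L).
Implicit Types (A B : set M) (I J : Type).

(** Predicates up to equivalence hide the syntax, and parameters are variables indexed by [B]
    itself, so Boolean operations and quantifiers need no bookkeeping of finite parameter tuples. *)
Definition definable B I (P : (I -> M) -> Prop) :=
  exists psi : formula L (I + B),
    forall a, P a <-> sat (sum_val a (fun b : B => val b)) psi.

Lemma definable_iff B I (P Q : (I -> M) -> Prop) :
  (forall a, P a <-> Q a) -> definable B P -> definable B Q.
Proof. by move=> PQ [psi H]; exists psi => a; rewrite -PQ. Qed.

Lemma definable_sat B I (phi : formula L I) :
  definable B (fun a => sat a phi).
Proof. by exists (fmap inl phi) => a; rewrite sat_fmap. Qed.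

Lemma definable_not B I (P : (I -> M) -> Prop) :
  definable B P -> definable B (fun a => ~ P a).
Proof. by move=> [p Hp]; exists (Neg p) => a; rewrite Hp. Qed.

Lemma definable_and B I (P Q : (I -> M) -> Prop) :
  definable B P -> definable B Q -> definable B (fun a => P a /\ Q a).
Proof. by move=> [p Hp] [q Hq]; exists (And p q) => a; rewrite sat_And Hp Hq. Qed.

Lemma definable_true B I : definable B (fun _ : I -> M => True).
Proof. by exists (Neg (Bot L _)) => a; split=> // _ []. Qed.

Lemma definable_forall B I (T : finType) (P : T -> (I -> M) -> Prop) :
  (forall x, definable B (P x)) -> definable B (fun a => forall x, P x a).
Proof.
move=> /choice [F FP]; exists (bigAnd [seq F x | x <- enum T]) => a.
by rewrite sat_bigAnd; split=> H x; apply/FP.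
Qed.

(** Renaming variables and plugging in constants from [B] are both special cases of such an [h]. *)
Lemma definable_subst B I J (h : I -> J + M) (P : (I -> M) -> Prop) :
  (forall i m, h i = inr m -> B m) -> definable B P ->
  definable B (fun b : J -> M => P (fun i => sum_val b id (h i))).
Proof.
move=> hB [psi H].
have /choice [g gP] : forall i, exists y : J + B, forall b : J -> M,
    sum_val b id (h i) = sum_val b (fun b : B => val b) y.
  move=> i; case E: (h i) => [j|m]; first by exists (inl j).
  by exists (inr (exist _ m (mem_set (hB _ _ E)))).
exists (fmap (fun y => match y with inl i => g i | inr b => inr b end) psi) => b.
rewrite H sat_fmap; suff -> : sum_val (fun i => sum_val b id (h i)) (fun b0 : B => val b0)
  = sum_val b (fun b0 : B => val b0) \o
    (fun y => match y with inl i => g i | inr b => inr b end) by [].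
by apply/funext => -[i|x] //=.
Qed.

Lemma definable_reindex B I J (g : I -> J) (P : (I -> M) -> Prop) :
  definable B P -> definable B (fun b : J -> M => P (b \o g)).
Proof. by move=> PB; apply: (definable_subst (h := inl \o g)) PB. Qed.

Lemma definable_exists B I J (P : (I + J -> M) -> Prop) :
  definable B P -> definable B (fun b : J -> M => exists a : I -> M, P (sum_val a b)).
Proof.
move=> [psi H].
pose g (x : (I + J) + B) : I + (J + B) :=
  match x with inl (inl i) => inl i | inl (inr j) => inr (inl j)
             | inr b => inr (inr b) end.
have [chi chiP] := exists_formula (fmap g psi); exists chi => b.
rewrite chiP; split=> -[a Ha]; exists a; move: Ha;
  rewrite H sat_fmap; congr sat; apply/funext => -[[]|] //.
Qed.

Lemma definable_mono A B I (P : (I -> M) -> Prop) :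
  A `<=` B -> definable A P -> definable B P.
Proof.
move=> AB [psi H].
pose g (x : I + A) : I + B := match x with
  | inl i => inl i
  | inr a => inr (exist _ (val a) (mem_set (AB _ (set_valP a)))) end.
exists (fmap g psi) => a; rewrite H sat_fmap.
suff -> : sum_val a (fun b : A => val b) = sum_val a (fun b : B => val b) \o g by [].
by apply/funext => -[].
Qed.

(** Turning the parameters [s] into variables lets [Q] be carried to other tuples with the type of
    [s] over [B]. *)
Lemma definable_setU_range B I J (s : J -> M) (P : (I -> M) -> Prop) :
  definable (B `|` range s) P ->
  exists Q : (J + I -> M) -> Prop, definable B Q /\ forall a, P a <-> Q (sum_val s a).
Proof.
move=> [psi H].
have /choice [g gP] : forall x : I + (B `|` range s : set M), exists y : (J + I) + B,
   forall a, sum_val a (fun b : (B `|` range s : set M) => val b) x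
           = sum_val (sum_val s a) (fun b : B => val b) y.
  move=> [i|m]; first by exists (inl (inr i)).
  have [Bm|[j _ sj]] := set_valP m; last by exists (inl (inl j)).
  by exists (inr (exist _ (val m) (mem_set Bm))).
exists (fun v => sat (sum_val v (fun b : B => val b)) (fmap g psi)); split.
  by exists (fmap g psi).
move=> a; rewrite H sat_fmap.
suff -> : sum_val a (fun b : (B `|` range s : set M) => val b) =
   sum_val (sum_val s a) (fun b : B => val b) \o g by [].
by apply/funext => x; rewrite gP.
Qed.

Lemma psat_inst I n (psi : formula L (I + 'I_n)) (b : 'I_n -> M) a :
  psat a (inst psi b) = sat (sum_val a b) psi.
Proof. by rewrite /psat /inst sat_fmap; congr sat; apply/funext => -[]. Qed.

Lemma definable_over B I (phi : pformula M I) :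
  over B phi -> definable B (fun a => psat a phi).
Proof.
move=> [n [psi [b [Bb ->]]]].
pose h (x : I + 'I_n) : I + M := match x with inl i => inl i | inr j => inr (b j) end.
have hB x m : h x = inr m -> B m by case: x => [i|j] [] // <-.
apply: definable_iff (definable_subst hB (definable_sat B psi)) => a.
rewrite psat_inst; suff -> : (fun x => sum_val a id (h x)) = sum_val a b by [].
by apply/funext => -[].
Qed.

Lemma over_definable B I (P : (I -> M) -> Prop) : definable B P ->
  exists phi : pformula M I, over B phi /\ forall a, psat a phi <-> P a.
Proof.
move=> [psi H]; have [W [h [psi0 E]]] := formula_finite_support psi.
suff [n [g [b [Bb gb]]]] : exists n (g : W -> I + 'I_n) (b : 'I_n -> M),
   (forall j, B (b j)) /\
   forall a w, sum_val a b (g w) = sum_val a (fun b : B => val b) (h w).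
  exists (inst (fmap g psi0) b); split; first by exists n, (fmap g psi0), b.
  move=> a; rewrite psat_inst H E !sat_fmap.
  suff -> : sum_val a b \o g = sum_val a (fun b : B => val b) \o h by [].
  by apply/funext => w /=; apply: gb.
(* The tuple [b] has one slot per element of [W]; the slots of proper variables are filled with
   [b0]. If [B] is empty, no parameter occurs and [b] has length 0. *)
have [[b0]|NB] := pselect (inhabited B).
  exists #|W|, (fun w => if h w is inl i then inl i else inr (enum_rank w)).
  exists (fun j => if h (enum_val j) is inr b then val b else val b0); split.
    by move=> j; case: (h _) => [_|b]; apply: set_valP.
  move=> a w; case E' : (h w) => [i|b] //=; by rewrite enum_rankK E'.
have /choice [g gP] : forall w, exists y : I, h w = inl y.
  by move=> w; case: (h w) => [i|b]; [exists i|case: NB].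
have b : 'I_0 -> M by case.
exists 0, (inl \o g), b; split; first by case.
by move=> a w; rewrite gP.
Qed.

Lemma definable_inst B I (P : (I -> M) -> Prop) : definable B P ->
  exists n (psi : formula L (I + 'I_n)) (b : 'I_n -> M),
    (forall j, B (b j)) /\ forall a, P a <-> sat (sum_val a b) psi.
Proof.
move=> /over_definable [phi [[n [psi [b [Bb ->]]]] H]]; exists n, psi, b.
by split=> // a; rewrite -H psat_inst.
Qed.

(** One implication suffices for equality of types, since definable predicates are closed under
    negation. *)
Definition eqtp B I (u v : I -> M) :=
  forall P : (I -> M) -> Prop, definable B P -> P u -> P v.

Lemma eqtp_iff B I (u v : I -> M) (P : (I -> M) -> Prop) :
  eqtp B u v -> definable B P -> P u <-> P v.
Proof.
move=> E DP; split; first exact: E.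
by move=> Pv; apply: contrapT => /(E _ (definable_not DP)); apply.
Qed.

Lemma eqtpP B I (u v : I -> M) : eqtp B u v <-> tp v B = tp u B.
Proof.
split=> [E|E P DP Pu].
  rewrite predeqE => phi; split=> -[o s]; split=> //;
    by move: s; apply eqtp_iff with (1 := E) (2 := definable_over o).
have [phi [o H]] := over_definable DP.
have : tp v B phi by rewrite E; split=> //; apply/H.
by move=> [_ /H].
Qed.

Lemma eqtp_sym B I (u v : I -> M) : eqtp B u v -> eqtp B v u.
Proof. by move=> /eqtpP E; apply/eqtpP. Qed.

Lemma eqtp_trans B I (u v w : I -> M) : eqtp B u v -> eqtp B v w -> eqtp B u w.
Proof. by move=> uv vw P DP /(uv _ DP)/(vw _ DP). Qed.

Lemma eqtp_mono A B I (u v : I -> M) : A `<=` B -> eqtp B u v -> eqtp A u v.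
Proof. by move=> AB E P DP; apply: E; apply: definable_mono DP. Qed.

Lemma eqtp_reindex B I J (g : J -> I) (u v : I -> M) :
  eqtp B u v -> eqtp B (u \o g) (v \o g).
Proof. by move=> E P DP; apply: (E (fun u => P (u \o g))); apply: definable_reindex. Qed.

Lemma sat_automorphism (h : M -> M) V (v : V -> M) (phi : formula L V) :
  automorphism h -> sat (h \o v) phi <-> sat v phi.
Proof.
move=> [bij hf hr].
have ev V' (v' : V' -> M) t : eval (h \o v') t = h (eval v' t).
  elim: t => //= f ts IH; rewrite hf; congr fint; exact/funext.
elim: phi v => {V} [V|V s t|V r ts|V phi IH1 psi IH2|V phi IH] v //=.
- by rewrite !ev; split=> [/(bij_inj bij)|->].
- rewrite -[X in _ <-> X]hr; suff -> : (fun i => eval (h \o v) (ts i)) = h \o (fun i => eval v (ts i)) by [].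
  by apply/funext => i; rewrite ev.
- by rewrite IH1 IH2.
- have [h' hK h'K] := bij.
  have E x : (fun o => if o is Some y then (h \o v) y else h x) =
     h \o (fun o => if o is Some y then v y else x) by apply/funext => -[].
  split=> H x; first by have := H (h x); rewrite E IH.
  by rewrite -(h'K x) E IH.
Qed.

Lemma definable_automorphism B (h : M -> M) I (a : I -> M) (P : (I -> M) -> Prop) :
  automorphism h -> (forall b, B b -> h b = b) -> definable B P -> P (h \o a) <-> P a.
Proof.
move=> ah hB [psi H]; rewrite !H.
have -> : sum_val (h \o a) (fun b : B => val b) = h \o sum_val a (fun b : B => val b).
  by apply/funext => -[x|b] //=; rewrite hB //; apply: set_valP.
exact: sat_automorphism.
Qed.

Lemma automorphism_id : automorphism (@id M).
Proof. by split=> [|f x|r x] //; exists id. Qed.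

Lemma automorphism_comp (g h : M -> M) :
  automorphism g -> automorphism h -> automorphism (g \o h).
Proof.
move=> [gb gf gr] [hb hf hr]; split; first exact: bij_comp.
- by move=> f x /=; rewrite hf gf.
- by move=> r x; rewrite -[X in _ <-> X]hr -[X in _ <-> X]gr.
Qed.

End Definability.

(** * Small sets *)

Section Small.
Variables (L : signature) (K : Type).
Hypothesis smallK : small K [set: formula L nat].

Lemma small_le U V (X : set U) (Y : set V) : X #<= Y -> small K Y -> small K X.
Proof.
move=> XY [YK KY]; split; first exact: card_le_trans YK.
by move=> KX; apply: KY; apply: card_le_trans XY.
Qed.

Lemma injective_card_le U V (X : set U) (Y : set V) (f : U -> V) :
  (forall x, X x -> Y (f x)) -> {in X &, injective f} -> X #<= Y.
Proof.
move=> fXY /inj_card_eq; rewrite card_eq_le => /andP[_ H].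
by apply: card_le_trans H _; apply: subset_card_le => _ [x Xx <-]; apply: fXY.
Qed.

Lemma small_countable U (X : set U) : countable X -> small K X.
Proof.
move=> cX; apply: small_le smallK; apply: card_le_trans cX _.
by apply: (@injective_card_le _ _ _ _ (fun n => Eq (Var L n) (Var L n))) => // m n _ _ [].
Qed.

(** If [X] is infinite, a sequence in [X] is shifted by the size of [J] to make room for [J]. *)
Lemma small_sum U (X : set U) (J : finType) : small K X -> small K [set: (X + J)%type].
Proof.
move=> sX; have [fX|iX] := pselect (finite_set X).
  apply: small_countable; apply: finite_set_countable.
  have -> : [set: X + J] = inl @` [set: X] `|` inr @` [set: J].
    by rewrite predeqE => -[x|j]; split=> // _; [left; exists x|right; exists j].
  rewrite finite_setU; split; apply: finite_image; last exact: finite_finset.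
  by rewrite (eq_finite_set (card_setT X)).
have [f fX finj] : exists2 f : nat -> U, (forall n, X (f n)) & injective f.
  have /infiniteP/card_leP[f] := iX.
  exists (fun n => val (f (exist _ n (mem_set I)))) => [n|m n /val_inj/(@inj _ _ _ f)].
    exact: set_valP.
  by move=> H; have /(congr1 val) := H (mem_set I) (mem_set I).
pose g (y : X + J) : U := match y with
  | inl x => if pselect (exists n, val x = f n) is left e
       then f (#|J| + projT1 (cid e)) else val x
  | inr j => f (enum_rank j) end.
apply: small_le sX; apply: (@injective_card_le _ _ _ _ g).
  by move=> [x|j] _ //=; case: pselect => // _; apply: set_valP.
have lt (j : J) n : enum_rank j = #|J| + n :> nat -> False.
  by move=> E; have := ltn_ord (enum_rank j); rewrite E ltnNge leq_addr.
move=> [x|j] [y|j'] _ _ /=.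
- case: pselect => [e|ne]; case: pselect => [e'|ne'].
  + move=> /finj/addnI; case: (cid e) => n /= nE; case: (cid e') => n' /= nE' E.
    by congr inl; apply: val_inj; rewrite [LHS]nE E -nE'.
  + by move=> E; case: ne'; eexists; rewrite -E.
  + by move=> E; case: ne; eexists; rewrite E.
  + by move=> /val_inj ->.
- case: pselect => [e /finj/esym/lt //|ne E].
  by case: ne; eexists; exact: E.
- case: pselect => [e /finj/lt //|ne E].
  by case: ne; eexists; rewrite -E.
- by move=> /finj/val_inj/enum_rank_inj ->.
Qed.

Lemma small_setU_range (M : Type) (B : set M) (J : finType) (s : J -> M) :
  small K B -> small K (B `|` range s).
Proof.
move=> /(small_sum J); apply: small_le.
have -> : B `|` range s = sum_val (fun b : B => val b) s @` [set: B + J].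
  rewrite predeqE => m; split=> [[Bm|[j _ <-]]|[[b|j] _ <-]].
  - by exists (inl (exist _ m (mem_set Bm))).
  - by exists (inr j).
  - by left; apply: set_valP.
  - by right; exists j.
exact: card_image_le.
Qed.

Lemma eqtp_automorphism (M : structure L) (B : set M) (J : finType) (u v : J -> M) :
  strongly_homogeneous M K -> small K B -> eqtp B u v ->
  exists h : M -> M, [/\ automorphism h, forall b, B b -> h b = b &
    forall j, h (u j) = v j].
Proof.
move=> hom sB E.
(* Homogeneity speaks of types over the empty set, so [B] is enumerated as part of the tuple; an
   automorphism carrying [w u] to [w v] then fixes [B] pointwise. *)
pose w (u : J -> M) := sum_val (fun b : B => val b) u.
have [|h [ah hP]] := hom _ (w u) (w v) (small_sum J sB).
  apply/esym/eqtpP => P [psi H] Pu.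
  have /choice [g gP] : forall x : (B + J) + (set0 : set M), exists y : J + B,
      forall u : J -> M, sum_val (w u) (fun b : (set0 : set M) => val b) x =
                         sum_val u (fun b : B => val b) y.
    by move=> [[b|j]|m]; [exists (inr b)|exists (inl j)|have := set_valP m].
  have wE u' : sum_val (w u') (fun b : (set0 : set M) => val b) =
      sum_val u' (fun b : B => val b) \o g by apply/funext => x /=; exact: gP.
  apply/H; rewrite wE -sat_fmap.
  apply: (E (fun u => sat (sum_val u (fun b : B => val b)) (fmap g psi))).
    by exists (fmap g psi).
  by rewrite sat_fmap -wE; apply/H.
exists h; split=> //.
- by move=> b Bb; have := hP (inl (exist _ b (mem_set Bb))).
- by move=> j; have := hP (inr j).
Qed.
End Small.

(** * Limits along ultrafilters *)

(** Dependent choice in which each term may depend on all earlier ones; [Inv] keeps the construction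
    going. *)
Lemma history_choice (X : Type) (Inv : seq X -> Prop) (R : seq X -> X -> Prop) :
  Inv [::] -> (forall s, Inv s -> exists2 x, R s x & Inv (rcons s x)) ->
  exists e : nat -> X, forall n, Inv (mkseq e n) /\ R (mkseq e n) (e n).
Proof.
move=> I0 IS; have [x0 _ _] := IS _ I0.
have /choice [G GP] : forall s, exists x, Inv s -> R s x /\ Inv (rcons s x).
  move=> s; have [/IS [x Rx Ix]|nI] := pselect (Inv s); first by exists x.
  by exists x0.
pose S n := iter n (fun s => rcons s (G s)) [::].
exists (fun n => G (S n)).
have SE n : mkseq (fun n => G (S n)) n = S n.
  by elim: n => [|n IH] //; rewrite mkseqS IH.
have SI n : Inv (S n) by elim: n => [|n /GP [_]].
by move=> n; rewrite SE; split=> //; have [] := GP _ (SI n).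
Qed.

Lemma finite_set_range T (F : set T) : finite_set F ->
  exists n (s : 'I_n -> T), F = range s.
Proof.
move=> fF; have [s E] := (finite_seqP (F : set {classic T})).1 fF.
exists (size s), (tnth (in_tuple s)).
rewrite E predeqE => x; split=> [xs|[i _ <-]]; last exact: mem_tnth.
by have /tnthP [i ->] : x \in in_tuple s by []; exists i.
Qed.

Lemma filter_forall_fin X (V : set_system X) (T : finType) (P : T -> set X) :
  Filter V -> (forall i, V (P i)) -> V [set x | forall i, P i x].
Proof.
move=> FV H.
have : V [set x | forall i, i \in enum T -> P i x].
  elim: (enum T) => [|y s IH]; first by apply: filterS filterT => x _ i; rewrite in_nil.
  apply: filterS (filterI (H y) IH) => x [Py Ps] i.
  by rewrite inE => /predU1P[->|/Ps].
by apply: filterS => x Hx i; apply: Hx; rewrite mem_enum.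
Qed.

Lemma ultra_not X (V : set_system X) (P : set X) :
  UltraFilter V -> V (~` P) <-> ~ V P.
Proof.
move=> UV; split=> [H1 H2|H]; last by have [] := in_ultra_setVsetC P UV.
by have [x []] := filter_ex (filterI H1 H2).
Qed.

Section FiniteSupport.
Variables (L : signature) (M : structure L).

Lemma definable_finite_support (B : set M) I (P : (I -> M) -> Prop) : definable B P ->
  exists (W : finType) (g : W -> I) (Q : (W -> M) -> Prop),
    definable B Q /\ forall a, P a <-> Q (a \o g).
Proof.
move=> [psi H]; have [W [h [psi0 E]]] := formula_finite_support psi.
have [[i0]|NI] := pselect (inhabited I).
  pose g w := if h w is inl i then i else i0.
  pose h' w : W + B := if h w is inr b then inr b else inl w.
  exists W, g, (fun y => sat (sum_val y (fun b : B => val b)) (fmap h' psi0)).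
  split; first by exists (fmap h' psi0).
  move=> a; rewrite H E !sat_fmap.
  suff -> : sum_val a (fun b : B => val b) \o h = sum_val (a \o g) (fun b : B => val b) \o h' by [].
  by apply/funext => w /=; rewrite /h' /g; case E' : (h w) => //=; rewrite E'.
have a0 : I -> M by move=> i; case: NI.
exists void, (@of_void I), (fun=> P a0); split.
  have [Pa|Pa] := pselect (P a0); first by apply: definable_iff (definable_true _ _).
  by apply: definable_iff (definable_not (definable_true B void)); split=> // [].
by move=> a; have -> : a = a0 by apply/funext => i; case: NI.
Qed.

Lemma definable_param (B : set M) I J (s : J -> M) (Q : (J + I -> M) -> Prop) :
  (forall j, B (s j)) -> definable B Q -> definable B (fun a => Q (sum_val s a)).
Proof.
pose h (x : J + I) : I + M := match x with inl j => inr (s j) | inr i => inl i end.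
move=> sB DQ; have hB x m : h x = inr m -> B m by case: x => [j [<-]|].
apply: definable_iff (definable_subst hB DQ) => a.
suff -> : (fun x => sum_val a id (h x)) = sum_val s a by [].
by apply/funext => -[].
Qed.

End FiniteSupport.

Section Limits.
Variables (L : signature) (M : structure L) (K : Type).
Hypotheses (smallK : small K [set: formula L nat]) (satM : saturated M K)
  (homM : strongly_homogeneous M K).

(** Saturation realizes types of finite tuples only, so the coordinates are chosen one at a time,
    each realizing the limit type along [V] over [B] and the earlier coordinates. *)
Lemma ultrafilter_realized_nat (B : set M) (V : set_system (nat -> M)) :
  UltraFilter V -> small K B ->
  exists b : nat -> M, forall P, definable B P -> (P b <-> V P).
Proof.
move=> UV sB; have [m0] := dom_inhabited M.
suff [b H] : exists b : nat -> M, forall P, definable B P -> V P -> P b.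
  exists b => P DP; split=> [Pb|]; last exact: H.
  by apply: contrapT => /(ultra_not _ UV) VN; apply: H (definable_not DP) VN Pb.
pose Inv (s : seq M) := forall (J : Type) (g : J -> nat), (forall j, g j < size s) ->
  forall P : (J -> M) -> Prop, definable B P -> V [set z : nat -> M | P (z \o g)] ->
  P (fun j => nth m0 s (g j)).
have [||e He] := @history_choice M Inv (fun _ _ => True).
- move=> J g g0 P DP /filter_ex [z Pz].
  suff <- : z \o g = (fun j => nth m0 [::] (g j)) by [].
  by apply/funext => j; have := g0 j.
- move=> s Is; pose n := size s; pose s' (i : 'I_n) := nth m0 s i.
  pose B' := B `|` range s'.
  pose ext (Q : ('I_n + 'I_1 -> M) -> Prop) :=
    V [set z : nat -> M | Q (sum_val (fun i : 'I_n => z i) (fun _ => z n))].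
  (* A formula over [B'] belongs to [q] when, with the entries of [s] freed into variables, it holds
     on a [V]-large set. *)
  pose q : set (pformula M 'I_1) := [set phi | over B' phi /\
    exists Q, [/\ definable B Q, forall y, psat y phi <-> Q (sum_val s' y) & ext Q]].
  have [] : exists a : 'I_1 -> M, realizes a q.
    apply: (satM (small_setU_range smallK s' sB)); split.
    + by move=> phi [].
    + move=> F /finite_set_range [r [t ->]] Fq.
      have /choice [Q QP] : forall i, exists Q, [/\ definable B Q,
          forall y, psat y (t i) <-> Q (sum_val s' y) & ext Q].
        by move=> i; have [|_ []] := Fq (t i); [exists i|move=> Q HQ; exists Q].
      pose QQ v := forall i, Q i v.
      have DQ : definable B QQ by apply: definable_forall => i; have [] := QP i.
      have VQ : ext QQ.
        by apply: (filter_forall_fin (P := fun i => [set z : nat -> M |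
          Q i (sum_val (fun i : 'I_n => z i) (fun _ => z n))])) => i; have [] := QP i.
      (* Finite consistency of [q]: the condition [Q'] is [V]-large, so the invariant makes it true
         of [s']. *)
      pose Q' v := exists y : 'I_1 -> M, QQ (sum_val v y).
      have DQ' : definable B Q'.
        pose sw (x : 'I_n + 'I_1) : 'I_1 + 'I_n :=
          match x with inl i => inr i | inr i => inl i end.
        apply: definable_iff (definable_exists (definable_reindex sw DQ)) => v.
        have E y : sum_val y v \o sw = sum_val v y by apply/funext => -[].
        by split=> -[y Hy]; exists y; move: Hy; rewrite E.
      have [y Hy] : Q' s'.
        apply: (Is 'I_n val (@ltn_ord n) Q' DQ').
        by apply: (filterS (F := V) _ VQ) => z Hz; exists (fun _ => z n).
      by exists y => _ [i _ <-]; have [_ H _] := QP i; apply/H.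
    + move=> phi o; have [Q [DQ QP]] := definable_setU_range (definable_over o).
      have [VQ|VQ] := in_ultra_setVsetC
        [set z : nat -> M | Q (sum_val (fun i : 'I_n => z i) (fun _ => z n))] UV.
        by left; split=> //; exists Q.
      right; split.
        by have [r [psi [b [Bb ->]]]] := o; exists r, (Neg psi), b.
      exists (fun v => ~ Q v); split=> //; first exact: definable_not.
      by move=> y; rewrite -QP.
  move=> a aq; exists (a ord0) => // J g gn P DP VP.
  pose h j : 'I_n + 'I_1 := if insub (g j) is Some i then inl i else inr ord0.
  have [phi [o H]] := over_definable (definable_param
     (fun j => or_intror (ex_intro2 _ _ j I erefl) : B' (s' j))
     (definable_mono (@subsetUl _ B (range s')) (definable_reindex h DP))).
  have : psat a phi.
    apply: aq; split=> //; exists (fun v => P (v \o h)); split=> //.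
      exact: definable_reindex.
    apply: (filterS (F := V) _ VP) => z /=.
    suff -> : z \o g = sum_val (fun i : 'I_n => z i) (fun=> z n) \o h by [].
    apply/funext => j /=; rewrite /h.
    case: (@insubP nat (fun x => x < n) 'I_n (g j)) => [i _ <- //|] /=.
    have := gn j; rewrite size_rcons ltnS leq_eqVlt.
    by move=> /predU1P[-> //|->].
  rewrite H; suff -> : sum_val s' a \o h = (fun j => nth m0 (rcons s (a ord0)) (g j)) by [].
  apply/funext => j /=; rewrite /h nth_rcons.
  case: (@insubP nat (fun x => x < n) 'I_n (g j)) => [i gi <-|] /=; first by rewrite ltn_ord.
  have := gn j; rewrite size_rcons ltnS leq_eqVlt.
  by move=> /predU1P[->|->] //; rewrite ltnn eqxx.
(* [P] reads only finitely many coordinates, all below [N], so the invariant at stage [N] yields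
   it. *)
exists e => P DP VP; have [W [g [Q [DQ QP]]]] := definable_finite_support DP.
pose N := (\max_w g w).+1.
have gN w : g w < size (mkseq e N) by rewrite size_mkseq ltnS leq_bigmax.
have [/(_ W g gN Q DQ) H _] := He N.
apply/QP; have -> : e \o g = (fun j => nth m0 (mkseq e N) (g j)).
  by apply/funext => w /=; rewrite nth_mkseq //; have := gN w; rewrite size_mkseq.
by apply: H; apply: (filterS (F := V) _ VP) => z /QP.
Qed.

(** The index type is coded in the natural numbers by [pickle], and [V] is pushed forward to
    sequences. *)
Lemma ultrafilter_realized (I : countType) (B : set M) (V : set_system (I -> M)) :
  UltraFilter V -> small K B ->
  exists b : I -> M, forall P, definable B P -> (P b <-> V P).
Proof.
move=> UV sB; have [m0] := dom_inhabited M.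
pose ext (a : I -> M) n := if unpickle n is Some i then a i else m0.
have extK a : ext a \o pickle = a by apply/funext => i; rewrite /ext /= pickleK.
have [G [UG VG]] := ultraFilterLemma (fmap_proper_filter ext (ultra_proper (UltraFilter := UV))).
have [b bP] := ultrafilter_realized_nat UG sB.
exists (b \o pickle) => P DP.
have imp Q : V Q -> G (fun z => Q (z \o pickle)).
  by move=> VQ; apply: VG; apply: (filterS (F := V) _ VQ) => a; rewrite -[X in Q X]extK.
rewrite (bP _ (definable_reindex pickle DP)); split=> [GP|]; last exact: imp.
apply: contrapT => /(ultra_not _ UV) /imp GN.
by have [z []] := filter_ex (filterI GP GN).
Qed.

End Limits.

(** * Dividing *)

Section Dividing.
Variables (L : signature) (M : structure L) (K : Type).
Hypotheses (smallK : small K [set: formula L nat]) (satM : saturated M K)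
  (homM : strongly_homogeneous M K).

Definition definable2 (B : set M) I J (R : (I -> M) -> (J -> M) -> Prop) :=
  definable B (fun v : I + J -> M => R (v \o inl) (v \o inr)).

Definition inconsistent I J (R : (I -> M) -> (J -> M) -> Prop) (c : nat -> J -> M)
    k (f : 'I_k -> nat) := ~ exists a, forall j, R a (c (f j)).

(** This is k-dividing over [B] of the instance of [R] at [b]; [k] is explicit because all levels of
    a tree must share it. *)
Definition kdivides (B : set M) I J (R : (I -> M) -> (J -> M) -> Prop) (b : J -> M) k :=
  exists c : nat -> J -> M, (forall i, eqtp B b (c i)) /\
    forall f : 'I_k -> nat, injective f -> inconsistent R c f.

(** Consistency of finitely many instances of [R] is a definable condition on their parameters; [g]
    declares each entry to be a variable or a constant. *)
Lemma definable_exists_conj B I J T (X : finType) (R : (I -> M) -> (J -> M) -> Prop)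
    (g : X -> J -> T + M) :
  (forall x j m, g x j = inr m -> B m) -> definable2 B R ->
  definable B (fun v => exists a, forall x, R a (fun j => sum_val v id (g x j))).
Proof.
move=> gB DR; pose h x (y : I + J) : (I + T) + M := match y with
  | inl i => inl (inl i)
  | inr j => match g x j with inl t => inl (inr t) | inr m => inr m end end.
have hB x y m : h x y = inr m -> B m.
  by case: y => [//|j] /=; case E: (g x j) => [//|m'] [<-]; apply: gB E.
apply: definable_iff
  (definable_exists (definable_forall (fun x => definable_subst (hB x) DR))) => v.
have E a x : (fun y => sum_val (sum_val a v) id (h x y)) \o inr
    = (fun j => sum_val v id (g x j)).
  by apply/funext => j /=; case: (g x j).
by split=> -[a Ha]; exists a => x; have := Ha x; rewrite E.
Qed.

Lemma definable2_paraml B I J (R : (I -> M) -> (J -> M) -> Prop) (a : I -> M) :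
  (forall i, B (a i)) -> definable2 B R -> definable B (R a).
Proof. by move=> aB DR; apply: definable_param aB DR. Qed.

Lemma definable2_paramr B I J (R : (I -> M) -> (J -> M) -> Prop) (b : J -> M) :
  (forall j, B (b j)) -> definable2 B R -> definable B (R^~ b).
Proof.
pose h (x : I + J) : I + M := match x with inl i => inl i | inr j => inr (b j) end.
move=> bB DR; have hB x m : h x = inr m -> B m by case: x => [|j [<-]].
exact: (definable_subst hB DR).
Qed.

Lemma definable_inconsistent B I J k (R : (I -> M) -> (J -> M) -> Prop) :
  definable2 B R ->
  definable B (fun v : 'I_k * J -> M => ~ exists a, forall i, R a (fun j => v (i, j))).
Proof.
by move=> DR; exact: definable_not
  (definable_exists_conj (g := fun (i : 'I_k) j => inl (i, j)) _ DR).
Qed.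

(** Finite approximations suffice: a limit of the pairs [(e', d)] is an infinite sequence whose
    terms relate to the limit of [e'] over [B] as [c] relates to [e]. An automorphism over [B] then
    moves that limit to [e]. *)
Lemma kdivides_limit (B : set M) (E J : finType) I (R : (I -> M) -> (J -> M) -> Prop) k
    (e : E -> M) (c : J -> M) :
  definable2 set0 R -> small K B ->
  (forall Q : (E + J -> M) -> Prop, definable B Q -> Q (sum_val e c) -> forall N,
     exists (e' : E -> M) (d : nat -> J -> M),
       (forall j, j < N -> Q (sum_val e' (d j))) /\
       forall f : 'I_k -> nat, injective f -> (forall j, f j < N) -> inconsistent R d f) ->
  kdivides (B `|` range e) R c k.
Proof.
move=> DR sB H.
pose T : countType := (E + nat * J)%type.
pose pt (v : T -> M) j : E + J -> M :=
  sum_val (fun x => v (inl x)) (fun i => v (inr (j, i))).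
pose D : set (((E + J -> M) -> Prop) * nat) :=
  [set p | definable B p.1 /\ p.1 (sum_val e c)].
pose base (p : ((E + J -> M) -> Prop) * nat) : set (T -> M) :=
  [set v | (forall j, j < p.2 -> p.1 (pt v j)) /\
     forall f : 'I_k -> nat, injective f -> (forall j, f j < p.2) ->
       inconsistent R (fun j i => v (inr (j, i))) f].
have [|V [UV VP]] := @ultraFilterLemma _ (filter_from D base).
  apply: filter_from_proper; first apply: filter_from_filter.
  - exists (fun=> True, 0); split=> //; exact: definable_true.
  - move=> [Q N] [Q' N'] [/= DQ Qc] [/= DQ' Qc'].
    exists (fun v => Q v /\ Q' v, maxn N N'); first by split=> //; apply: definable_and.
    move=> v [/= Hv fv]; split; split=> /= [j jN|f fi fN].
    + by apply: (Hv _ _).1; rewrite leq_max jN.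
    + by apply: fv => // j; rewrite leq_max fN.
    + by apply: (Hv _ _).2; rewrite leq_max jN orbT.
    + by apply: fv => // j; rewrite leq_max fN orbT.
  - move=> [Q N] [/= DQ Qc]; have [e' [d [Hd fd]]] := H Q DQ Qc N.
    by exists (sum_val e' (fun x => d x.1 x.2)); split.
have [b bP] := ultrafilter_realized smallK satM UV sB.
pose e' x := b (inl x); pose c' j i := b (inr (j, i)).
have tr (Q : (E + J -> M) -> Prop) j : definable B Q -> Q (sum_val e c) -> Q (sum_val e' (c' j)).
  move=> DQ Qc; pose h (x : E + J) : T := match x with inl i => inl i | inr i => inr (j, i) end.
  have hE (v : T -> M) : v \o h = pt v j by apply/funext => -[].
  have : Q (b \o h).
    apply/(bP _ (definable_reindex h DQ)); apply: VP; exists (Q, j.+1) => //.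
    by move=> v [/= /(_ j (ltnSn j))] + _; rewrite -hE.
  by rewrite hE.
(* Inconsistency is definable without parameters and concerns finitely many terms, so it survives
   the limit. *)
have inc f : injective f -> inconsistent R c' (k := k) f.
  move=> fi; pose h (x : 'I_k * J) : T := inr (f x.1, x.2).
  have DI := definable_mono (@sub0set _ B) (definable_inconsistent k DR).
  apply/(bP _ (definable_reindex h DI)); apply: VP.
  exists (fun=> True, (\max_j f j).+1); first by split=> //; exact: definable_true.
  by move=> v [/= _ /(_ f fi)]; apply => j; rewrite ltnS leq_bigmax.
have Ee : eqtp B e' e.
  apply: eqtp_sym => P DP Pe.
  exact: (tr (fun v => P (v \o inl)) 0 (definable_reindex inl DP)).
have [h [ah hB he]] := eqtp_automorphism smallK homM sB Ee.
exists (fun j => h \o c' j); split=> [j P DP Pc|f fi].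
  have [Q [DQ QP]] := definable_setU_range DP.
  have /(tr _ j DQ) := (QP c).1 Pc.
  rewrite -(definable_automorphism _ ah hB DQ) QP.
  by have -> : h \o sum_val e' (c' j) = sum_val e (h \o c' j) by apply/funext => -[x|] /=.
have DI := definable_mono (@sub0set _ B) (definable_inconsistent k DR).
pose v (x : 'I_k * J) := c' (f x.1) x.2.
exact: (definable_automorphism v ah hB DI).2 (inc f fi).
Qed.

Lemma kdivides_mono (A B : set M) I J (R : (I -> M) -> (J -> M) -> Prop) c k :
  A `<=` B -> kdivides B R c k -> kdivides A R c k.
Proof. by move=> AB [d [dB H]]; exists d; split=> // i; apply: eqtp_mono (dB i). Qed.

Lemma kdivides_limit0 (B : set M) (J : finType) I
    (R : (I -> M) -> (J -> M) -> Prop) (c : J -> M) k :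
  definable2 set0 R -> small K B ->
  (forall Q : (J -> M) -> Prop, definable B Q -> Q c ->
     exists d : nat -> J -> M, (forall j, Q (d j)) /\
       forall f : 'I_k -> nat, injective f -> inconsistent R d f) ->
  kdivides B R c k.
Proof.
move=> DR sB H; have e0 : void -> M by [].
apply: (@kdivides_mono _ (B `|` range e0)); first exact: subsetUl.
apply: kdivides_limit => // Q DQ Qc N.
have [|d [Qd Id]] := H (fun y => Q (sum_val e0 y)) _ Qc.
  by apply: definable_param DQ => -[].
by exists e0, d; split=> // f fi _; apply: Id.
Qed.

(* The usual proof needs an indiscernible witness of dividing. Here it suffices
   that, by nondividing, arbitrarily large finite parts of any witness share a
   realization of a given formula of [tp(e/Bc)]. *)
Lemma kdivides_extend (B : set M) (E J : finType) I (R : (I -> M) -> (J -> M) -> Prop) k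
    (e : E -> M) (c : J -> M) :
  definable2 set0 R -> small K B ->
  (forall (Q : (E -> M) -> (J -> M) -> Prop) N, definable2 B Q -> Q e c -> ~ kdivides B Q c N) ->
  kdivides B R c k -> kdivides (B `|` range e) R c k.
Proof.
move=> DR sB nd [d [dB dk]]; apply: kdivides_limit => // Q DQ Qec N.
pose Q2 x y := Q (sum_val x y).
have DQ2 : definable2 B Q2.
  apply: definable_iff DQ => v; rewrite /Q2.
  suff -> : sum_val (v \o inl) (v \o inr) = v by [].
  by apply/funext => -[].
have : exists f : 'I_N -> nat, injective f /\ exists e', forall j, Q2 e' (d (f j)).
  apply: contrapT => nf; apply: (nd Q2 N DQ2 Qec); exists d; split=> // f fi.
  by move=> ex; apply: nf; exists f.
move=> [f [fi [e' He']]].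
pose d' j := d (if insub j is Some i then f i else 0).
exists e', d'; split=> [j jN|g gi gN [a Ha]].
  by rewrite /d' insubT; exact: He'.
apply: (dk (fun i => f (Ordinal (gN i)))); first by move=> i j /fi [] /gi.
by exists a => j; have := Ha j; rewrite /d' (insubT (fun i => i < N) (gN j)).
Qed.

End Dividing.

(** * The tree property in the monster model *)

Lemma unbounded_injection (P : nat -> Prop) :
  (forall N, exists2 j, N <= j & P j) ->
  exists2 g : nat -> nat, injective g & forall i, P (g i).
Proof.
move=> H; have [||g gP] := @history_choice nat (fun _ => True)
    (fun s x => P x /\ forall y, y \in s -> y < x).
- by [].
- move=> s _; have [x sx Px] := H (\max_(y <- s) y).+1; exists x => //; split=> // y ys.
  by apply: leq_ltn_trans sx; rewrite (big_rem y) //= leq_maxl.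
exists g => [|i]; last by have [_ []] := gP i.
have lt i j : i < j -> g i < g j.
  move=> ij; have [_ [_]] := gP j; apply.
  by apply/mapP; exists i; rewrite // mem_iota.
move=> i j E; case: (ltngtP i j) => // /lt; by rewrite E ltnn.
Qed.

Lemma mkseq_cons (X : Type) (x : X) (f : nat -> X) n :
  mkseq (fun i => if i is i'.+1 then f i' else x) n.+1 = x :: mkseq f n.
Proof. by rewrite /mkseq /= (iotaDl 1 0) -map_comp. Qed.

(** [V] is a limit of the sequence at infinity: whatever definable property a realization of its
    limit type has, arbitrarily late terms have it too. *)
Lemma ultra_of_tails X (t : nat -> X) :
  exists V : set_system X, UltraFilter V /\
    forall P : set X, V P -> forall N, exists2 j, N <= j & P (t j).
Proof.
pose base N := [set t j | j in [set j | N <= j]].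
have [|V [UV VP]] := @ultraFilterLemma _ (filter_from setT base).
  apply: filter_from_proper; last by move=> N _; exists (t N), N => /=.
  apply: filter_from_filter; first by exists 0.
  move=> N N' _ _; exists (maxn N N') => // _ [j /= Hj <-].
  by split; exists j => //=; apply: leq_trans Hj; rewrite ?leq_maxl ?leq_maxr.
exists V; split=> // P PV N.
have VN : V (base N) by apply: VP; exists N.
have [x [Pj [j Nj xE]]] := filter_ex (filterI PV VN).
by exists j => //; rewrite xE.
Qed.

Lemma exists_conj_formula (L : signature) I J T (X : finType) (phi : formula L (I + J))
    (g : X -> J -> T) :
  exists chi : formula L T, forall (M : structure L) (v : T -> M),
    sat v chi <-> exists a : I -> M, forall x, sat (sum_val a (v \o g x)) phi.
Proof.
pose h x (y : I + J) : I + T := match y with inl i => inl i | inr j => inr (g x j) end.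
have [chi chiP] := exists_formula (bigAnd [seq fmap (h x) phi | x <- enum X]).
have E (M : structure L) (v : T -> M) (a : I -> M) x : sum_val a v \o h x = sum_val a (v \o g x).
  by apply/funext => -[].
exists chi => M v; rewrite chiP.
split=> -[a Ha]; exists a.
  by move=> x; move/sat_bigAnd: Ha => /(_ x); rewrite sat_fmap E.
by apply/sat_bigAnd => x; rewrite sat_fmap E.
Qed.

Section NonSimple.
Variables (L : signature) (T : set (sentence L)) (M : structure L) (K : Type).
Hypotheses (smallK : small K [set: formula L nat]) (satM : saturated M K)
  (homM : strongly_homogeneous M K) (complT : complete_theory T) (MT : models T M).

(** The existential closure of a formula true of [c] holds in [N], hence in [M] by completeness. The
    formulas of [c] are thus finitely satisfiable in [M], and a limit realizes them together. *)
Lemma elementary_copy (I : countType) (N : structure L) (c : I -> N) :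
  models T N -> exists b : I -> M, forall chi : formula L I, sat c chi -> sat b chi.
Proof.
move=> NT.
pose base (chi : formula L I) := [set v : I -> M | sat v chi].
have [|V [UV VP]] := @ultraFilterLemma _ (filter_from [set chi | sat c chi] base).
  apply: filter_from_proper; first apply: filter_from_filter.
  - by exists (Neg (Bot L I)) => - [].
  - move=> chi chi' /= H H'; exists (And chi chi'); first exact/sat_And.
    by move=> v /sat_And.
  - move=> chi /= H; have [s sP] := exists_formula (fmap (@inl I void) chi).
    have sN : holds N s.
      by apply/sP; exists c; rewrite sat_fmap.
    have : holds M s.
      have [_ /(_ s) [Hs|Hs]] := complT; first exact: Hs.
      by case: ((Hs _ NT : holds N s -> False) sN).
    by move=> /sP [a]; rewrite sat_fmap => Ha; exists a.
have [b bP] := ultrafilter_realized smallK satM UV (small_countable smallK (@countable0 M)).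
exists b => chi H; apply/(bP _ (definable_sat _ _)); apply: VP; by exists chi.
Qed.

Section Tree.
Variables (n m : nat) (phi : formula L ('I_n + 'I_m)) (k : nat).

Definition holds_at (x : 'I_n -> M) (y : 'I_m -> M) := sat (sum_val x y) phi.

Lemma definable_holds_at B : definable2 B holds_at.
Proof.
apply: definable_iff (definable_sat B phi) => v.
rewrite /holds_at; suff -> : sum_val (v \o inl) (v \o inr) = v by [].
by apply/funext => -[].
Qed.

Lemma tree_in_monster : tree_property T phi k ->
  exists c : seq nat -> 'I_m -> M,
    (forall s (f : 'I_k -> nat), injective f ->
       ~ exists x, forall j, holds_at x (c (rcons s (f j)))) /\
    (forall eta l, exists x, forall i, i < l -> holds_at x (c (mkseq eta i.+1))).
Proof.
move=> [N [NT [c [c1 c2]]]].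
have [b bP] := elementary_copy (fun x : seq nat * 'I_m => c x.1 x.2) NT.
exists (fun s i => b (s, i)); split=> [s f fi ex|eta l].
  have [chi chiP] := exists_conj_formula phi (fun j i => (rcons s (f j), i)).
  apply: (bP (Neg chi)); last by apply/chiP.
  by move=> /chiP; apply: c1.
have [chi chiP] := exists_conj_formula phi (fun (j : 'I_l) i => (mkseq eta j.+1, i)).
have /bP/chiP [x Hx] : sat (fun x : seq nat * 'I_m => c x.1 x.2) chi.
  by apply/chiP; have [x Hx] := c2 eta l; exists x => j; apply: Hx.
by exists x => i il; have := Hx (Ordinal il).
Qed.

Variable y0 : 'I_m -> M.

Definition entries (l : seq ('I_m -> M)) : set M :=
  [set e | exists2 i, i < size l & exists j, nth y0 l i j = e].

Lemma small_setU_entries B l : small K B -> small K (B `|` entries l).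
Proof.
have -> : entries l = range (fun x : 'I_(size l) * 'I_m => nth y0 l x.1 x.2).
  rewrite predeqE => e; split=> [[i il [j <-]]|[[i j] _ <-]].
    by exists (Ordinal il, j).
  by exists i => //; exists j.
exact: (small_setU_range smallK).
Qed.

Lemma small_entries l : small K (entries l).
Proof.
rewrite -[entries l]set0U; apply: small_setU_entries.
exact: (small_countable smallK (@countable0 M)).
Qed.

(** The invariant for building a dividing chain: [l] is the part of the path already fixed, and the
    finite paths of the tree [t] remain consistent with it. *)
Definition tree_above (l : seq ('I_m -> M)) :=
  exists t : seq nat -> 'I_m -> M,
    (forall s (f : 'I_k -> nat), injective f ->
       ~ exists x, forall j, holds_at x (t (rcons s (f j)))) /\
    (forall eta d, exists x, (forall i, i < size l -> holds_at x (nth y0 l i)) /\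
       forall i, i < d -> holds_at x (t (mkseq eta i.+1))).

(** The next point is a limit of the children of the root. A formula of its type over [entries l] is
    shared by infinitely many children, which are k-inconsistent, so [phi] divides there. The
    subtrees at the children converge to the new tree at the same time. *)
Lemma tree_above_step l : tree_above l ->
  exists2 c, kdivides (entries l) holds_at c k & tree_above (rcons l c).
Proof.
move=> [t [t1 t2]].
(* [tt j] is the whole subtree at child [j], with the child itself stored at [[::]]. *)
pose tt j (x : seq nat * 'I_m) := t (j :: x.1) x.2.
have [V [UV VP]] := ultra_of_tails tt.
have [b bP] := ultrafilter_realized smallK satM UV (small_entries l).
have key P : definable (entries l) P -> P b -> forall N, exists2 j, N <= j & P (tt j).
  by move=> DP /(bP _ DP) /VP.
pose c i := b ([::], i); exists c.
  apply: (kdivides_limit0 smallK satM homM); [exact: definable_holds_at|exact: small_entries|].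
  move=> Q DQ Qc.
  have [g gi gP] := unbounded_injection (key _ (definable_reindex (fun i => ([::], i)) DQ) Qc).
  exists (fun j => t [:: g j]); split=> // f fi.
  by apply: (t1 [::] (g \o f)) => i j /gi /fi.
exists (fun s i => b (s, i)); split=> [s f fi ex|eta d].
  have [//|j _ [x Hx]] := key _ (definable_exists_conj (T := (seq nat * 'I_m)%type)
     (g := fun j i => inl (rcons s (f j), i)) _ (definable_holds_at _)) ex 0.
  by apply: (t1 (j :: s) f fi); exists x => i; have := Hx i.
pose g (x : 'I_(size l) + option 'I_d) (i : 'I_m) : (seq nat * 'I_m) + M := match x with
  | inl j => inr (nth y0 l j i)
  | inr None => inl ([::], i)
  | inr (Some j) => inl (mkseq eta j.+1, i) end.
have gB x i e : g x i = inr e -> entries l e.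
  by case: x => [j [<-]|[]] //; exists j => //; exists i.
have Dg := definable_exists_conj gB (definable_holds_at _).
have [x Hx] : exists x, forall y, holds_at x (fun j => sum_val b id (g y j)).
  apply: contrapT => /(key _ (definable_not Dg)) /(_ 0) [j _]; apply.
  (* The branch goes through child [j] and then along [eta], hence the length [d.+1]. *)
  have [x [xl xd]] := t2 (fun i => if i is i'.+1 then eta i' else j) d.+1.
  exists x => -[i|[i|]] /=; first exact: xl.
    by have := xd i.+1 (ltn_ord i); rewrite mkseq_cons.
  by apply: (xd 0).
exists x; split=> [i|i id]; last exact: (Hx (inr (Some (Ordinal id)))).
rewrite size_rcons nth_rcons ltnS leq_eqVlt => /predU1P[->|il].
  by rewrite ltnn eqxx; apply: (Hx (inr None)).
by rewrite il; apply: (Hx (inl (Ordinal il))).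
Qed.

End Tree.
End NonSimple.

(** * Strict non-forking equal to non-forking implies simple *)

Section StrictImpliesSimple.
Variables (L : signature) (T : set (sentence L)) (M : structure L) (K : Type).
Hypotheses (smallK : small K [set: formula L nat]) (satM : saturated M K)
  (homM : strongly_homogeneous M K) (complT : complete_theory T) (MT : models T M).
Variables (n m : nat) (phi : formula L ('I_n + 'I_m)) (k : nat).
Notation R := (holds_at (M := M) phi).

Lemma small_sequence_entries (c : nat -> 'I_m -> M) :
  small K [set e | exists l j, c l j = e].
Proof.
have -> : [set e | exists l j, c l j = e] = range (fun x : nat * 'I_m => c x.1 x.2).
  rewrite predeqE => e; split=> [[l [j <-]]|[[l j] _ <-]]; last by exists l, j.
  by exists (l, j).
apply: (small_countable smallK).
by apply: card_le_trans (card_image_le _ _) _; exact: countableP.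
Qed.

(** Iterating [tree_above_step] from the empty path gives the chain; [a] is a limit of realizations
    of its finite initial parts. *)
Lemma dividing_sequence : tree_property T phi k ->
  exists (a : 'I_n -> M) (c : nat -> 'I_m -> M), (forall i, R a (c i)) /\
    forall i, kdivides [set e | exists2 l, l < i & exists j, c l j = e] R (c i) k.
Proof.
move=> tree; have [m0] := dom_inhabited M; pose y0 (i : 'I_m) := m0.
have [||c cP] := @history_choice ('I_m -> M) (tree_above phi k y0)
    (fun l c => kdivides (entries y0 l) R c k).
- have [t [t1 t2]] := tree_in_monster smallK satM complT MT tree.
  by exists t; split=> // eta d; have [x Hx] := t2 eta d; exists x.
- by move=> l /(tree_above_step smallK satM homM).
have DR B : definable2 B R by exact: definable_holds_at.
have Ec i : entries y0 (mkseq c i) = [set e | exists2 l, l < i & exists j, c l j = e].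
  rewrite predeqE => e; split=> -[l]; rewrite ?size_mkseq => li [j E];
    by exists l; rewrite ?size_mkseq //; exists j; move: E; rewrite nth_mkseq.
pose A := [set e | exists l j, c l j = e].
pose base N := [set x : 'I_n -> M | forall i, i < N -> R x (c i)].
have [|V [UV VP]] := @ultraFilterLemma _ (filter_from setT base).
  apply: filter_from_proper.
    apply: filter_from_filter; first by exists 0.
    move=> N N' _ _; exists (maxn N N') => // x Hx.
    by split=> i iN; apply: Hx; rewrite leq_max iN ?orbT.
  move=> N _; have [[t [_ /(_ id 0) [x [Hx _]]]] _] := cP N.
  by exists x => i iN; have := Hx i; rewrite size_mkseq nth_mkseq //; apply.
have [a aP] := ultrafilter_realized smallK satM UV (small_sequence_entries c).
exists a, c; split=> [i|i]; last by rewrite -Ec; have [] := cP i.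
have D : definable A (fun x => R x (c i)).
  by apply: definable2_paramr (DR A) => j; exists i, j.
by apply/(aP _ D); apply: VP; exists i.+1 => // x; apply.
Qed.

Lemma simple_of_strict :
  (forall (I J : Type) (a : I -> M) (b : J -> M) (A : set M),
      small K [set: I] -> small K [set: J] -> small K A ->
      nonforking_indep A a b -> strict_indep K A a b) -> ~ tree_property T phi k.
Proof.
move=> strict /dividing_sequence [a [c [Rac divc]]].
have DR B : definable2 B R by exact: definable_holds_at.
pose A := [set e | exists l j, c l j = e].
have sA : small K A := small_sequence_entries c.
pose Aa := A `|` range a.
have sAa : small K Aa := small_setU_range smallK a sA.
have [V [UV VP]] := ultra_of_tails c.
have [w wP] := ultrafilter_realized smallK satM UV sAa.
have key P : definable Aa P -> P w -> forall N, exists2 j, N <= j & P (c j).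
  by move=> DP /(wP _ DP) /VP.
have aAa i : Aa (a i) by right; exists i.
have Raw : R a w.
  apply: contrapT => nR.
  by have [j _] := key _ (definable_not (definable2_paraml aAa (DR Aa))) nR 0; apply.
(* A formula over [A] true of [w] uses entries of finitely many [c l]. It holds of some later [c i],
   hence of every term of a sequence witnessing that [c i] divides over the earlier entries. *)
have divw : kdivides A R w k.
  apply: (kdivides_limit0 smallK satM homM) => // Q DQ Qw.
  have [r [psi [b [bA QE]]]] := definable_inst DQ.
  have /choice [N bN] : forall j, exists l, exists i, c l i = b j by move=> j; exact: bA.
  have [i Ni Qi] := key _ (definable_mono (@subsetUl _ A (range a)) DQ) Qw (\max_j N j).+1.
  have [d [dE dk]] := divc i; exists d; split=> // j; apply: (dE j Q) Qi.
  apply: definable_iff (definable2_paramr (R := fun y b => sat (sum_val y b) psi) (b := b) _ _).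
  - by move=> y; rewrite QE.
  - move=> l; exists (N l); last exact: bN.
    by apply: leq_trans Ni; rewrite ltnS leq_bigmax.
  - exact: definable_holds_at.
(* If the type forked, some [c j] would satisfy a formula dividing over [A]. The entries of [c j]
   lie in [A], so [c j] would satisfy all conjugates of that formula over [A], against their
   inconsistency. *)
have nf : nonforking_indep A w a.
  move=> [chi [[F [fF FT Fchi]] [G [fG GA chiG]]]].
  have [r [s Es]] := finite_set_range fF.
  have [j _ Fj] : exists2 j, 0 <= j & forall i, psat (c j) (s i).
    have sT i : tp w Aa (s i) by apply: FT; rewrite Es; exists i.
    apply: (key (fun y => forall i, psat y (s i))) => [|i]; last by have [] := sT i.
    by apply: definable_forall => i; apply: definable_over; have [] := sT i.
  have /chiG [psi Gpsi cpsi] : psat (c j) chi.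
    by apply: Fchi => f; rewrite Es => -[i _ <-].
  have [q [rho [b [Ep [d [q' [dE dk]]]]]]] := GA _ Gpsi.
  apply: (dk val val_inj); exists (c j) => i; rewrite psat_inst.
  have /eqtpP dE' := dE (val i).
  apply: (dE' (fun y => sat (sum_val (c j) y) rho)).
    apply: (definable2_paraml (R := fun x y => sat (sum_val x y) rho)).
      by move=> l; exists j, l.
    exact: definable_holds_at.
  by move: cpsi; rewrite Ep psat_inst.
have so l : small K [set: 'I_l] by apply: (small_countable smallK); exact: countableP.
have [p [[pover pfin pcomp] wp _ pD]] := strict _ _ _ _ _ (so m) (so n) sA nf.
(* [p] is consistent and contains the type of [w] over [Aa], which is complete. *)
have wr : realizes w (p `&` over Aa).
  move=> f [pf of_]; apply: contrapT => nf'.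
  have : p (Neg f).
    apply: wp; split=> //; have [r [psi [b [bB ->]]]] := of_.
    by exists r, (Neg psi), b.
  move=> pNf; have [] := pfin [set f; Neg f].
  - exact: finite_set2.
  - by move=> _ [->|->].
  - by move=> x xr; apply: (xr (Neg f)); [right|apply: (xr f); left].
(* Strictness is tested at [Aa] itself: [phi], with its first variables at the entries of [a], lies
   in the type of [Aa] over [A] and [w], and divides over [A]. *)
apply: (pD Aa sAa _ w wr) => //.
pose g i : Aa := exist _ (a i) (mem_set (aAa i)).
pose h (x : 'I_n + 'I_m) : Aa + 'I_m := match x with inl i => inl (g i) | inr j => inr j end.
have hE (y : Aa -> M) (b : 'I_m -> M) : psat y (inst (fmap h phi) b) = R (y \o g) b.
  rewrite psat_inst sat_fmap /holds_at; congr sat; by apply/funext => -[].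
exists (inst (fmap h phi) w); split.
  exists [set inst (fmap h phi) w]; split=> [|f ->|y]; [exact: finite_set1| |].
  - split; first by exists m, (fmap h phi), w; split=> // j; right; exists j.
    by rewrite hE.
  - by apply.
exists m, (fmap h phi), w; split=> //; have [d [dE dk]] := divw; exists d, k.
split=> [i|f fi [y Hy]]; first by apply/eqtpP; exact: dE.
by apply: (dk f fi); exists (y \o g) => j; rewrite -hE.
Qed.

End StrictImpliesSimple.

(** * Simple implies strict non-forking equal to non-forking *)

Definition sum_map X X' Y Y' (g : X -> X') (h : Y -> Y') (x : X + Y) : X' + Y' :=
  match x with inl a => inl (g a) | inr b => inr (h b) end.

Lemma finite_range_injective (W : finType) X (f : W -> option X) :
  exists n (g : 'I_n -> X), injective g /\ forall w x, f w = Some x -> exists i, g i = x.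
Proof.
pose s : seq {classic X} := undup (pmap (f : W -> option {classic X}) (enum W)).
exists (size s), (tnth (in_tuple s)); split.
  exact: (elimT (tuple_uniqP (in_tuple s)) (undup_uniq _)).
move=> w x E; have /tnthP [i ->] : (x : {classic X}) \in in_tuple s; last by exists i.
by rewrite mem_undup mem_pmap -E map_f // mem_enum.
Qed.

(** Injectivity of [g] is what allows a valuation of the first variables to be extended to all of
    [X]. *)
Lemma formula_sum_support (L : signature) X Y (phi : formula L (X + Y)) :
  exists n m (g : 'I_n -> X) (h : 'I_m -> Y) (psi : formula L ('I_n + 'I_m)),
    injective g /\ phi = fmap (sum_map g h) psi.
Proof.
have [W [f [psi ->]]] := formula_finite_support phi.
have [n [g [gi gP]]] := finite_range_injective (fun w => if f w is inl x then Some x else None).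
have [m [h [_ hP]]] := finite_range_injective (fun w => if f w is inr x then Some x else None).
have /choice [e eP] : forall w, exists z, sum_map g h z = f w.
  move=> w; case E: (f w) => [x|y].
    by have [|i <-] := gP w x; [rewrite E|exists (inl i)].
  by have [|i <-] := hP w y; [rewrite E|exists (inr i)].
exists n, m, g, h, (fmap e psi); split=> //; rewrite fmap_fmap.
by congr fmap; apply/funext => w /=; rewrite eP.
Qed.

(** * Trees from finite dividing chains *)

Section Chains.
Variables (L : signature) (M : structure L) (K : Type).
Hypotheses (smallK : small K [set: formula L nat]) (satM : saturated M K)
  (homM : strongly_homogeneous M K).
Variables (n m : nat) (phi : formula L ('I_n + 'I_m)) (k : nat).
Notation R := (holds_at (M := M) phi).

(* The node [s] is [c (size s - 1)] moved by [sigma 0 s], a product of automorphisms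
   [tau l j] that fix [c 0, ..., c (l-1)] and move [c l] to the [j]-th term of a
   sequence witnessing that it divides. *)
Lemma tree_of_chain (c : nat -> 'I_m -> M) N x0 :
  (forall l, l < N -> kdivides [set e | exists2 i, i < l & exists j, c i j = e] R (c l) k) ->
  (forall l, l < N -> R x0 (c l)) ->
  exists t : seq nat -> 'I_m -> M,
    (forall s (f : 'I_k -> nat), size s < N -> injective f ->
       ~ exists x, forall j, R x (t (rcons s (f j)))) /\
    (forall eta l, l <= N -> exists x, forall i, i < l -> R x (t (mkseq eta i.+1))).
Proof.
move=> divc Rx0.
pose C l := [set e | exists2 i, i < l & exists j, c i j = e].
have sC l : small K (C l).
  apply: (small_countable smallK); apply: finite_set_countable.
  have -> : C l = range (fun x : 'I_l * 'I_m => c x.1 x.2).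
    rewrite predeqE => e; split=> [[i il [j <-]]|[[i j] _ <-]].
      by exists (Ordinal il, j).
    by exists i => //; exists j.
  by apply: finite_image; exact: finite_finset.
have /choice [tau tauP] : forall l, exists tau : nat -> M -> M,
    (forall j, automorphism (tau j)) /\ (l < N -> (forall j b, C l b -> tau j b = b) /\
       forall f : 'I_k -> nat, injective f -> inconsistent R (fun j => tau j \o c l) f).
  move=> l; have [lN|lN] := boolP (l < N); last first.
    by exists (fun=> id); split=> // j; exact: automorphism_id.
  have [d [dE dk]] := divc l lN.
  have /choice [tau tauP] := fun j => eqtp_automorphism smallK homM (sC l) (dE j).
  exists tau; split=> [j|_]; first by have [] := tauP j.
  split=> [j|f fi]; first by have [] := tauP j.
  move=> [x Hx]; apply: (dk f fi); exists x => j.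
  have -> : d (f j) = tau (f j) \o c l; last exact: Hx.
  by apply/funext => i /=; have [] := tauP (f j).
pose fix sigma l (s : seq nat) : M -> M :=
  if s is j :: s' then tau l j \o sigma l.+1 s' else id.
have sigma_rcons l s j : sigma l (rcons s j) = sigma l s \o tau (l + size s) j.
  elim: s l => [|i s IH] l /=; first by rewrite addn0.
  by rewrite IH addSnnS.
have sigma_aut l s : automorphism (sigma l s).
  elim: s l => [|i s IH] l /=; first exact: automorphism_id.
  by apply: automorphism_comp => //; have [] := tauP l.
exists (fun s => sigma 0 s \o c (size s).-1); split=> [s f sN fi|eta l lN].
  have [_ /(_ sN) [_ /(_ f fi)]] := tauP (size s).
  pose v (x : 'I_k * 'I_m) := tau (size s) (f x.1) (c (size s) x.2).
  have DI := definable_inconsistent k (@definable_holds_at _ M _ _ phi set0).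
  have AI := definable_automorphism v (sigma_aut 0 s) (fun b (h : set0 b) => False_ind _ h) DI.
  move=> /AI nI [x Hx]; apply: nI; exists x => j; have := Hx j.
  by rewrite size_rcons sigma_rcons.
exists (sigma 0 (mkseq eta l) \o x0) => i il; rewrite size_mkseq /=.
(* The factors [tau l] with [i < l] fix [c i], so a single image of [x0] realizes the whole
   branch. *)
have -> : sigma 0 (mkseq eta i.+1) \o c i = sigma 0 (mkseq eta l) \o c i.
  elim: l il lN => // l IH; rewrite ltnS leq_eqVlt => /predU1P[-> //|il] lN.
  rewrite (IH il (ltnW lN)) (mkseqS _ l) sigma_rcons size_mkseq.
  apply/funext => j /=; have [_ /(_ lN) [-> //]] := tauP l.
  by exists i => //; exists j.
have E : sum_val (sigma 0 (mkseq eta l) \o x0) (sigma 0 (mkseq eta l) \o c i) =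
  sigma 0 (mkseq eta l) \o sum_val x0 (c i) by apply/funext => -[].
rewrite /holds_at E; apply/sat_automorphism; first exact: sigma_aut.
by apply: Rx0; apply: leq_trans lN.
Qed.

(** The trees of height [N] converge to an infinite tree: each requirement concerns finitely many
    nodes and holds in all sufficiently tall trees. *)
Lemma tree_property_of_chains (T : set (sentence L)) (c : nat -> nat -> 'I_m -> M) x0 :
  models T M ->
  (forall N l, l < N ->
     kdivides [set e | exists2 i, i < l & exists j, c N i j = e] R (c N l) k) ->
  (forall N l, l < N -> R (x0 N) (c N l)) -> tree_property T phi k.
Proof.
move=> MT divc Rx0; exists M; split=> //.
have /choice [t tP] := fun N => tree_of_chain (divc N) (Rx0 N).
have [V [UV VP]] := ultra_of_tails (fun N (x : seq nat * 'I_m) => t N x.1 x.2).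
have [b bP] := ultrafilter_realized smallK satM UV (small_countable smallK (@countable0 M)).
have key P : definable set0 P -> P b -> forall N, exists2 j, N <= j &
    P (fun x : seq nat * 'I_m => t j x.1 x.2) by move=> DP /(bP _ DP) /VP.
exists (fun s i => b (s, i)); split=> [s f fi ex|eta l].
  have [//|N sN [x Hx]] := key _ (definable_exists_conj (T := (seq nat * 'I_m)%type)
     (g := fun j i => inl (rcons s (f j), i)) _ (definable_holds_at phi _)) ex (size s).+1.
  by have [t1 _] := tP N; apply: (t1 s f sN fi); exists x => i; have := Hx i.
have Dg := definable_exists_conj (T := (seq nat * 'I_m)%type) (B := set0)
     (g := fun (j : 'I_l) i => inl (mkseq eta j.+1, i)) (fun x j e => ltac:(by [])) (definable_holds_at (M := M) phi _).
have [x Hx] : exists x, forall i : 'I_l, R x (fun j => b (mkseq eta i.+1, j)).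
  apply: contrapT => /(key _ (definable_not Dg)) /(_ l) [N lN]; apply.
  have [_ /(_ eta l lN) [x Hx]] := tP N; exists x => i; exact: Hx.
by exists x => i il; apply: (Hx (Ordinal il)).
Qed.

End Chains.

(** * Nonforking types as ultrafilters *)

Section Nonforking.
Variables (L : signature) (M : structure L).

(** Nonforking says that no finite part of [pi] is covered by finitely many dividing formulas, which
    makes the sets [base p] a filter base. [V] stands for a global nonforking extension of [pi]. *)
Lemma ultrafilter_nonforking (A : set M) I (pi : set (pformula M I)) :
  ~ type_forks A pi ->
  exists V : set_system (I -> M), [/\ UltraFilter V,
    forall phi, pi phi -> V [set x | psat x phi] &
    forall psi, divides A psi -> ~ V [set x | psat x psi]].
Proof.
move=> nf.
pose D : set (set (pformula M I) * set (pformula M I)) :=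
  [set p | [/\ finite_set p.1, p.1 `<=` pi, finite_set p.2 & p.2 `<=` divides A]].
pose base (p : set (pformula M I) * set (pformula M I)) :=
  [set x : I -> M | realizes x p.1 /\ forall psi, p.2 psi -> ~ psat x psi].
have [|V [UV VP]] := @ultraFilterLemma _ (filter_from D base).
  apply: filter_from_proper; first apply: filter_from_filter.
  - by exists (set0, set0); split=> //=; exact: finite_set0.
  - move=> [F G] [F' G'] [/= fF Fp fG Gd] [/= fF' Fp' fG' Gd'].
    exists (F `|` F', G `|` G').
      split=> /=; [by rewrite finite_setU|by move=> x [/Fp|/Fp']|
        by rewrite finite_setU|by move=> x [/Gd|/Gd']].
    move=> x [/= xF xG]; split; split=> /= psi H.
    + by apply: xF; left.
    + by apply: xG; left.
    + by apply: xF; right.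
    + by apply: xG; right.
  - move=> [F G] [/= fF Fp fG Gd]; apply: contrapT => nx; apply: nf.
    have [r [s Es]] := finite_set_range fF.
    have sE x : psat x (bigAnd [seq s i | i <- enum 'I_r]) <-> realizes x F.
      rewrite /psat sat_bigAnd Es; split=> [H _ [i _ <-]|H i]; first exact: H.
      by apply: H; exists i.
    exists (bigAnd [seq s i | i <- enum 'I_r]); split.
      by exists F; split=> // x /sE.
    exists G; split=> // x /sE xF; apply: contrapT => nG; apply: nx; exists x.
    by split=> // psi Gpsi xpsi; apply: nG; exists psi.
exists V; split=> //.
- move=> phi piphi; apply: VP; exists ([set phi], set0); last by move=> x [/= + _]; apply.
  by split=> /=; [exact: finite_set1|move=> _ ->|exact: finite_set0|].
- move=> psi dpsi; apply/ultra_not; apply: VP; exists (set0, [set psi]).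
    by split=> /=; [exact: finite_set0| |exact: finite_set1|move=> _ ->].
  by move=> x [_ /=]; apply.
Qed.

Lemma divides_display (A : set M) I (X : finType) (psi : formula L (I + X)) (b : X -> M) k :
  kdivides A (fun a y => sat (sum_val a y) psi) b k ->
  exists phi : pformula M I, divides A phi /\ forall a, psat a phi <-> sat (sum_val a b) psi.
Proof.
move=> [d [dE dk]].
have E a (y : X -> M) : psat a (inst (fmap (sum_map id enum_rank) psi) (y \o enum_val)) =
    sat (sum_val a y) psi.
  rewrite psat_inst sat_fmap; congr sat.
  by apply/funext => -[i|x] //=; rewrite enum_rankK.
exists (inst (fmap (sum_map id enum_rank) psi) (b \o enum_val)); split=> [|a]; last by rewrite E.
exists #|X|, (fmap (sum_map id enum_rank) psi), (b \o enum_val); split=> //.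
exists (fun i => d i \o enum_val), k; split=> [i|f fi [a Ha]].
  by apply/eqtpP; apply: eqtp_reindex.
by apply: (dk f fi); exists a => j; rewrite -E.
Qed.

(* The parameters from [A] in the range of [h] are harmless: they stay fixed along
   a sequence of realizations of a type over [B]. *)
Lemma not_kdivides_nonforking (A B : set M) I m (V : set_system (I -> M)) (h : 'I_m -> I + A)
    (Q : ('I_m -> M) -> ('I_m -> M) -> Prop) z k :
  (forall psi, divides A psi -> ~ V [set x | psat x psi]) -> Filter V -> A `<=` B ->
  definable2 B Q ->
  V [set x | Q (fun j => sum_val x (fun a : A => val a) (h j)) z] -> ~ kdivides B Q z k.
Proof.
move=> Vd FV AB DQ VQ [d [dE dk]].
have [r [theta [t [tB thetaE]]]] := definable_inst DQ.
pose u (x : I -> M) j := sum_val x (fun a : A => val a) (h j).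
(* The slots are for the constants from [A], for [z], and for the parameters [t] of [Q]. A slot
   [inl j] for which [h j] is a variable is a dummy, filled by [z j]. *)
pose X : finType := ('I_m + ('I_m + 'I_r))%type.
pose s (y : ('I_m + 'I_m) + 'I_r) : I + X := match y with
  | inl (inl j) => if h j is inl i then inl i else inr (inl j)
  | inl (inr j) => inr (inr (inl j))
  | inr l => inr (inr (inr l)) end.
pose h' (x : X) : 'I_m + M := match x with
  | inl j => if h j is inr a then inr (val a) else inl j
  | inr (inl j) => inl j
  | inr (inr l) => inr (t l) end.
pose b (z : 'I_m -> M) (x : X) := sum_val z id (h' x).
have E x y : sat (sum_val x (b y)) (fmap s theta) = Q (u x) y.
  have /propext -> := thetaE (sum_val (u x) y); rewrite sat_fmap; congr sat.
  apply/funext => -[[j|j]|l] //=; rewrite /u.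
  by case E : (h j) => [i|a] //=; rewrite /b /h' E.
have hB x e : h' x = inr e -> B e.
  case: x => [j|[j|l]] //=; last by move=> [<-].
  by case: (h j) => [//|a] [<-]; apply: AB; apply: set_valP.
have [|phi [dphi phiE]] := @divides_display A I X (fmap s theta) (b z) k.
  exists (b \o d); split=> [i P DP|f fi [a Ha]].
    exact: (dE i _ (definable_subst hB (definable_mono AB DP))).
  by apply: (dk f fi); exists (u a) => j; rewrite -E; exact: Ha.
apply: (Vd _ dphi); apply: (filterS (F := V) _ VQ) => x /=.
by rewrite phiE E.
Qed.

End Nonforking.

(** * Chains from a failure of strictness *)

Section Simple.
Variables (L : signature) (T : set (sentence L)) (M : structure L) (K : Type).
Hypotheses (smallK : small K [set: formula L nat]) (satM : saturated M K)
  (homM : strongly_homogeneous M K) (MT : models T M).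

(** The dividing formula may have parameters outside [A] and [c], so it is replaced by the finite
    part of the type that implies it. Automorphisms over [A] moving [b] along its dividing sequence
    carry the implication, and hence the inconsistency, along. *)
Lemma type_divides_display (A : set M) I X (c : I -> M) (y0 : X -> M) :
  small K A -> type_divides A (tp y0 (A `|` range c)) ->
  exists n m (phi : formula L ('I_n + 'I_m)) (g : 'I_n -> X) (h : 'I_m -> I + A) k,
    let u x j := sum_val x (fun a : A => val a) (h j) in
    [/\ 2 <= k, holds_at phi (y0 \o g) (u c) & kdivides A (holds_at phi) (u c) k].
Proof.
move=> sA [phi0 [[F [fF FT Fphi]] [r [psi [b [Ephi [d [k [dE dk]]]]]]]]].
have [q [s Es]] := finite_set_range fF.
have sT i : tp y0 (A `|` range c) (s i) by apply: FT; rewrite Es; exists i.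
have [|Q [[theta thetaE] QP]] :=
  @definable_setU_range L M A X I c (fun y => forall i, psat y (s i)).
  by apply: definable_forall => i; apply: definable_over; have [] := sT i.
pose assoc (x : (I + X) + A) : X + (I + A) := match x with
  | inl (inl i) => inr (inl i) | inl (inr j) => inl j | inr a => inr (inr a) end.
have [n [m [g [h [phi [gi E]]]]]] := formula_sum_support (fmap assoc theta).
pose u x j := sum_val x (fun a : A => val a) (h j).
have QE x y : Q (sum_val x y) <-> holds_at phi (y \o g) (u x).
  have := congr1 (sat (sum_val y (sum_val x (fun a : A => val a)))) E.
  rewrite thetaE /holds_at !sat_fmap => EE.
  have E1 : sum_val (y \o g) (u x) =
    sum_val y (sum_val x (fun a : A => val a)) \o sum_map g h by apply/funext => -[].
  rewrite E1 -EE; suff -> : sum_val (sum_val x y) (fun a : A => val a) =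
    sum_val y (sum_val x (fun a : A => val a)) \o assoc by [].
  by apply/funext => -[[]|].
(* Adding 2 secures [2 <= k]; inconsistency of any [k] instances passes to larger numbers. *)
exists n, m, phi, g, h, k.+2; split=> //.
  by apply/QE/QP => i; have [] := sT i.
have Qpsi y : Q (sum_val c y) -> sat (sum_val y b) psi.
  move=> /QP sy; rewrite -psat_inst -Ephi; apply: Fphi => f.
  by rewrite Es => -[i _ <-].
have /choice [tau tauP] := fun i => eqtp_automorphism smallK homM sA ((eqtpP _ _ _).2 (dE i)).
exists (fun i => tau i \o u c); split=> [i P DP Pu|f fi [x Hx]].
  by have [ai Ai _] := tauP i; apply/(definable_automorphism _ ai Ai DP).
have [m0] := dom_inhabited M.
pose y j := if pselect (exists i, g i = j) is left e then x (projT1 (cid e)) else m0.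
have yg : y \o g = x.
  apply/funext => i /=; rewrite /y; case: pselect => [e|[]]; last by exists i.
  by case: (cid e) => i' /= /gi ->.
pose w (j : 'I_k) : 'I_k.+2 := widen_ord (leqW (leqnSn k)) j.
have wi : injective w by move=> i j /(congr1 val) /= /val_inj.
apply: (dk (f \o w)); first by move=> i j /fi /wi.
exists y => j; rewrite psat_inst /=; have := Hx (w j).
have [ai Ai bi] := tauP (f (w j)).
have [[tau' tauK tau'K] _ _] := ai.
have -> : tau (f (w j)) \o u c = u (tau (f (w j)) \o c).
  by apply/funext => i /=; rewrite /u; case: (h i) => [//|a]; apply: Ai; apply: set_valP.
(* Pulling [y] back by the automorphism reaches the original [c], where [Q] implies [psi]; pushing
   forward again turns [b] into the term of [d]. *)
rewrite -yg -QE; have yE : y = tau (f (w j)) \o (tau' \o y).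
  by apply/funext => i /=; rewrite tau'K.
have -> : sum_val (tau (f (w j)) \o c) y = tau (f (w j)) \o sum_val c (tau' \o y).
  by rewrite [in LHS]yE; apply/funext => -[].
have DQ : definable A Q by exists theta.
rewrite (definable_automorphism _ ai Ai DQ) => /Qpsi.
rewrite -(sat_automorphism _ _ ai).
suff -> : tau (f (w j)) \o sum_val (tau' \o y) b = sum_val y (d (f (w j))) by [].
by apply/funext => -[i|i] /=; [rewrite tau'K|exact: bi].
Qed.

Lemma tree_property_of_type_divides (A D : set M) I (V : set_system (I -> M)) (c : I -> M) :
  UltraFilter V -> (forall psi, divides A psi -> ~ V [set x | psat x psi]) ->
  A `<=` D -> small K D -> (forall P, definable D P -> P c -> V P) ->
  type_divides A (tp (fun d : D => val d) (A `|` range c)) ->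
  exists n m (phi : formula L ('I_n + 'I_m)) k, 2 <= k /\ tree_property T phi k.
Proof.
move=> UV Vd AD sD cV tdiv.
have sA : small K A by apply: small_le sD; apply: subset_card_le.
have [n [m [phi [g [h [k [k2 Ruc divu]]]]]]] := type_divides_display sA tdiv.
exists n, m, phi, k; split=> //.
pose u (x : I -> M) j := sum_val x (fun a : A => val a) (h j).
rewrite -/u in Ruc divu; set x0 := (_ \o g) in Ruc.
have DR B : definable2 B (holds_at (M := M) phi) by exact: definable_holds_at.
have [m0] := dom_inhabited M; pose y0 (i : 'I_m) := m0.
(* [W] gives the limit type of the finite tuple [u x]; each [e i] will realize it over [D] and the
   earlier terms. *)
have [W [UW WP]] := ultraFilterLemma (fmap_proper_filter u (ultra_proper (UltraFilter := UV))).
have WV P : W P -> V (P \o u).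
  move=> WPP; apply: contrapT => /(ultra_not _ UV) VN.
  have WN : W (~` P) by apply: WP.
  by have [x []] := filter_ex (filterI WPP WN).
have [||e eP] := @history_choice ('I_m -> M) (fun=> True)
    (fun s x => forall P, definable (D `|` entries y0 s) P -> (P x <-> W P)).
- by [].
- move=> s _; have [x xP] := ultrafilter_realized smallK satM UW
    (small_setU_entries smallK y0 s sD).
  by exists x.
have {eP} eP i P : definable (D `|` entries y0 (mkseq e i)) P -> (P (e i) <-> W P).
  by have [_] := eP i; apply.
have Ee i j l : l < i -> entries y0 (mkseq e i) (e l j).
  by move=> li; exists l; rewrite ?size_mkseq //; exists j; rewrite nth_mkseq.
pose hu j : I + M := match h j with inl i => inl i | inr a => inr (val a) end.
have huD j a : hu j = inr a -> D a.
  by rewrite /hu; case: (h j) => // a' [<-]; apply: AD; apply: set_valP.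
have huE x : u x = fun j => sum_val x id (hu j).
  by apply/funext => j; rewrite /hu /u; case: (h j).
(* Over [D] the tuple [e i] has the type of [u c], so it inherits both [phi] at [x0] and dividing
   over [A]. *)
have ue i P : definable D P -> P (u c) -> P (e i).
  move=> DP Pc; apply/eP; first by apply: definable_mono DP; exact: subsetUl.
  apply: WP; apply: cV => //; apply: definable_iff (definable_subst huD DP) => x.
  by rewrite -huE.
have Rxe i : holds_at phi x0 (e i).
  apply: ue => //; apply: definable2_paraml (DR D) => j; exact: set_valP.
have dive i : kdivides A (holds_at phi) (e i) k.
  have [d [dE dk]] := divu; exists d; split=> // j; apply: eqtp_trans (dE j).
  by apply: eqtp_sym => P DP; apply: ue; apply: definable_mono DP.
(* The terms after [e i] are added to the base one at a time, and [e i] keeps dividing. *)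
pose B i j := A `|` [set y | exists2 l, i < l < j & exists i', e l i' = y].
have BD i j : B i j `<=` D `|` entries y0 (mkseq e j).
  move=> y [/AD|[l /andP[_ lj] [i' <-]]]; [by left|right; exact: Ee].
have sB i j : small K (B i j).
  by apply: small_le (small_setU_entries smallK y0 (mkseq e j) sD); apply: subset_card_le.
have divB i j : i < j -> kdivides (B i j) (holds_at phi) (e i) k.
  elim: j => // j IH; rewrite ltnS leq_eqVlt => /predU1P[->|ij].
    apply: kdivides_mono (dive j) => y [//|[l /andP[jl]]].
    by rewrite ltnS leqNgt jl.
  have BS : B i j.+1 `<=` B i j `|` range (e j).
    move=> y [Ay|[l /andP[il]]]; first by left; left.
    rewrite ltnS leq_eqVlt => /predU1P[->|lj] [i' <-]; first by right; exists i'.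
    by left; right; exists l; [rewrite il|exists i'].
  apply: kdivides_mono BS _; apply: (kdivides_extend smallK satM homM) => //; last exact: IH.
  (* [e j] realizes [W] over a set containing [B i j] and [e i], so [Q] at [e i] is [V]-large and
     does not divide. *)
  move=> Q N DQ Qe; apply: (not_kdivides_nonforking (h := h) Vd _ _ DQ).
    by move=> y Ay; left.
  have DQe : definable (D `|` entries y0 (mkseq e j)) (Q^~ (e i)).
    apply: definable2_paramr; last exact: definable_mono DQ.
    by move=> i'; right; exact: Ee.
  by apply: (WV (Q^~ (e i))); apply/(eP _ _ DQe).
(* Reading the first [N] terms backwards turns terms of larger index into predecessors in the
   chain. *)
apply: (tree_property_of_chains smallK satM homM (c := fun N l => e (N - l.+1))
  (x0 := fun=> x0) MT) => // N l lN.
apply: (@kdivides_mono _ _ _ (B (N - l.+1) N)); last by apply: divB; rewrite ltn_subrL (leq_ltn_trans _ lN).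
move=> y [i il [j <-]]; right; exists (N - i.+1); last by exists j.
by rewrite ltn_subrL (leq_ltn_trans _ lN) // andbT ltn_sub2l // ?ltnS // (leq_trans _ lN).
Qed.

End Simple.

Theorem theorem7p6 (L : signature) (T : set (sentence L)) (K : Type)
    (M : structure L) :
  complete_theory T -> monster K T M ->
  ((forall (I J : Type) (a : I -> M) (b : J -> M) (A : set M),
      small K [set: I] -> small K [set: J] -> small K A ->
      (strict_indep K A a b <-> nonforking_indep A a b))
   <-> simple T).
Proof.
move=> complT [MT smallK satM homM]; split=> [H|simT I J a b A sI sJ sA].
  move=> [n [m [phi [k [_]]]]].
  apply: (simple_of_strict smallK satM homM complT MT) => I J a b A sI sJ sA nf.
  exact/H.
split=> [[p [_ tpp nfp _]] [phi [[F [fF FT Fphi]] fk]]|].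
  by apply: nfp; exists phi; split=> //; exists F; split=> // x /FT /tpp.
move=> /ultrafilter_nonforking [V [UV Vtp Vd]].
have overT B X (phi : pformula M X) : over B phi -> over [set: M] phi.
  by move=> [r [psi [t [_ ->]]]]; exists r, psi, t.
(* The limit type of [V] is global because [V] decides every formula, and nonforking because [V]
   avoids any finite set of dividing formulas at once. *)
pose p := [set phi : pformula M I | over [set: M] phi /\ V [set x | psat x phi]].
have Vfin F : finite_set F -> F `<=` p -> V [set x | realizes x F].
  move=> /finite_set_range [r [s ->]] Fp.
  have : V [set x | forall i, psat x (s i)].
    apply: (filter_forall_fin (P := fun i => [set x | psat x (s i)])) => i.
    by have [|_] := Fp (s i); first by exists i.
  by apply: filterS => x Hx _ [i _ <-].
exists p; split.
- split=> [phi []|F fF Fp|phi o] //; first exact: filter_ex (Vfin F fF Fp).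
  have [VP|VP] := in_ultra_setVsetC [set x | psat x phi] UV; [by left|right].
  by split=> //; have [r [psi [t [tB ->]]]] := o; exists r, (Neg psi), t.
- by move=> phi tphi; split; [apply: overT tphi.1|exact: Vtp].
- move=> [phi [[F [fF Fp Fphi]] [G [/finite_set_range [r [s ->]] Gd phiG]]]].
  have nG : V [set x | forall i, ~ psat x (s i)].
    apply: (filter_forall_fin (P := fun i => [set x | ~ psat x (s i)])) => i.
    by apply/(ultra_not [set x | psat x (s i)] UV); apply: Vd; apply: Gd; exists i.
  have [x [xF xG]] := filter_ex (filterI (Vfin F fF Fp) nG).
  by have [_ [i _ <-]] := phiG x (Fphi x xF); exact: xG.
- move=> D sD AbD c cp tdiv; apply: simT.
  apply: (tree_property_of_type_divides smallK satM homM MT UV Vd _ sD _ tdiv).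
    by move=> x Ax; apply: AbD; left.
  (* Since [c] realizes [p] over [D], what is true of [c] over [D] must be [V]-large. *)
  move=> P DP Pc; apply: contrapT => /(ultra_not _ UV) VN.
  have [phi [o phiE]] := over_definable (definable_not DP).
  suff : psat c phi by move/phiE; apply.
  apply: cp; split=> //; split; first exact: overT o.
  by apply: (filterS (F := V) _ VN) => x /phiE.
Qed.
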